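(* Let $\mathsf{X}\subset\mathbb{R}^d$ be compact, contained in the ball of radius $R$ centered at the origin, and let $\alpha,\beta\in\mathcal{M}_+(\mathsf{X})$. Then $\mathrm{SUOT}(\alpha,\beta)\le\mathrm{USOT}(\alpha,\beta)$.
   Context: Fix entropy functions $\varphi_1,\varphi_2$ (convex, l.s.c., domain in $[0,\infty)$, $\varphi(1)=0$) and a cost $\mathrm{C}_1$ on $\mathbb{R}\times\mathbb{R}$. $\mathrm{D}_\varphi(\mu|\nu)=\int\varphi(\frac{d\mu}{d\nu})d\nu+\varphi'_\infty\mu^\perp(\mathbb{R}^s)$, $\varphi'_\infty=\lim\varphi(x)/x$. $\mathrm{UOT}(\mu,\nu)=\inf_{\pi\ge0}\int\mathrm{C}_1d\pi+\mathrm{D}_{\varphi_1}(\pi_1|\mu)+\mathrm{D}_{\varphi_2}(\pi_2|\nu)$ for measures on $\mathbb{R}$ ($\pi_1,\pi_2$ marginals), $\mathrm{OT}$ the balanced version. With $\boldsymbol\sigma$ uniform on $\mathbb{S}^{d-1}$, $\theta^\star(x)=\langle\theta,x\rangle$: $\mathrm{SOT}(\alpha,\beta)=\int\mathrm{OT}(\theta^\star_\sharp\alpha,\theta^\star_\sharp\beta)d\boldsymbol\sigma$, $\mathrm{SUOT}(\alpha,\beta)=\int\mathrm{UOT}(\theta^\star_\sharp\alpha,\theta^\star_\sharp\beta)d\boldsymbol\sigma$, $\mathrm{USOT}(\alpha,\beta)=\inf_{\pi_1,\pi_2\in\mathcal{M}_+(\mathbb{R}^d)}\mathrm{SOT}(\pi_1,\pi_2)+\mathrm{D}_{\varphi_1}(\pi_1|\alpha)+\mathrm{D}_{\varphi_2}(\pi_2|\beta)$.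 *)

(* Defs.v *)
From HB Require Import structures.
From mathcomp Require Import all_boot all_order all_algebra.
From mathcomp Require Import all_classical all_reals all_analysis.
Import Order.TTheory GRing.Theory Num.Theory.
Import numFieldNormedType.Exports.

Set Implicit Arguments.
Unset Strict Implicit.
Unset Printing Implicit Defensive.

Local Open Scope classical_set_scope.
Local Open Scope ring_scope.

(* R^d is modelled by d.-tuple R, with its canonical product (= Borel)
   sigma-algebra from MathComp-Analysis.  The real line carries its
   canonical (Borel) sigma-algebra, R x R the product one. *)

Section Defs.
Context {R : realType}.

Definition proj {d : nat} (theta x : d.-tuple R) : R :=
  \sum_(i < d) tnth theta i * tnth x i.

Definition enorm {d : nat} (x : d.-tuple R) : R := Num.sqrt (proj x x).

Definition sphere (d : nat) : set (d.-tuple R) := [set x | enorm x = 1].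

Definition mx_act {d : nat} (Q : 'M[R]_d) (x : d.-tuple R) : d.-tuple R :=
  [tuple \sum_(j < d) Q i j * tnth x j | i < d].

(* identification of d.-tuple R with row vectors, used to transport the
   (product) topology of 'rV[R]_d, e.g. to speak of compact sets *)
Definition tuple_to_row {d : nat} (x : d.-tuple R) : 'rV[R]_d :=
  \row_(j < d) tnth x j.

(* sigma is the uniform probability measure on S^{d-1}: the (unique)
   probability measure carried by the sphere and invariant under every
   orthogonal transformation. *)
Definition uniform_on_sphere {d : nat}
    (sigma : set (d.-tuple R) -> \bar R) : Prop :=
  [/\ sigma [set: d.-tuple R] = 1%E,
      sigma (@sphere d) = 1%E &
      forall Q : 'M[R]_d, Q *m Q^T = 1%:M ->
        forall A, measurable A -> sigma (mx_act Q @^-1` A) = sigma A].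

Local Open Scope ereal_scope.

Definition entropy_function (phi : R -> \bar R) : Prop :=
  [/\ (forall x, phi x != -oo),
      (forall x : R, (x < 0)%R -> phi x = +oo),
      (forall (x y t : R), (0 <= t <= 1)%R ->
          phi (t * x + (1 - t) * y)%R <= t%:E * phi x + (1 - t)%:E * phi y),
      (forall a : R, closed [set x : R | phi x <= a%:E]) &
      phi 1%R = 0].

Definition recession (phi : R -> \bar R) : \bar R :=
  lim (phi x * (x^-1)%:E @[x --> +oo%R]).

Definition lebesgue_decomp {dT} {T : measurableType dT}
    (mu nu : set T -> \bar R) (h : T -> R) (N : set T) : Prop :=
  [/\ measurable N, nu N = 0, measurable_fun [set: T] h,
      (forall x, 0 <= h x)%R &
      forall A, measurable A ->
        mu A = \int[nu]_(x in A) (h x)%:E + mu (A `&` N)].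

(* D_phi(mu | nu) = int phi(dmu/dnu) dnu + phi'_oo mu^perp(whole space).
   The value does not depend on the chosen decomposition; we take the
   infimum over all of them (a singleton set of values). *)
Definition divergence {dT} {T : measurableType dT} (phi : R -> \bar R)
    (mu nu : set T -> \bar R) : \bar R :=
  ereal_inf [set v | exists (h : T -> R) (N : set T),
     lebesgue_decomp mu nu h N /\
     v = \int[nu]_x phi (h x) + recession phi * mu N].

Definition OT (C1 : R * R -> \bar R) (mu nu : set R -> \bar R) : \bar R :=
  ereal_inf [set v | exists pi : {finite_measure set (R * R)%type -> \bar R},
     [/\ (forall A, measurable A -> pi (fst @^-1` A) = mu A),
         (forall A, measurable A -> pi (snd @^-1` A) = nu A) &
         v = \int[pi]_z C1 z]].

Definition UOT (C1 : R * R -> \bar R) (phi1 phi2 : R -> \bar R)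
    (mu nu : set R -> \bar R) : \bar R :=
  ereal_inf [set v | exists pi : {finite_measure set (R * R)%type -> \bar R},
     v = \int[pi]_z C1 z
         + divergence phi1 (pushforward pi fst) mu
         + divergence phi2 (pushforward pi snd) nu].

Definition SOT {d : nat} (sigma : set (d.-tuple R) -> \bar R)
    (C1 : R * R -> \bar R) (a b : set (d.-tuple R) -> \bar R) : \bar R :=
  \int[sigma]_(theta in @sphere d)
     OT C1 (pushforward a (proj theta)) (pushforward b (proj theta)).

Definition SUOT {d : nat} (sigma : set (d.-tuple R) -> \bar R)
    (C1 : R * R -> \bar R) (phi1 phi2 : R -> \bar R)
    (a b : set (d.-tuple R) -> \bar R) : \bar R :=
  \int[sigma]_(theta in @sphere d)
     UOT C1 phi1 phi2 (pushforward a (proj theta)) (pushforward b (proj theta)).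

Definition USOT {d : nat} (sigma : set (d.-tuple R) -> \bar R)
    (C1 : R * R -> \bar R) (phi1 phi2 : R -> \bar R)
    (a b : set (d.-tuple R) -> \bar R) : \bar R :=
  ereal_inf [set v | exists p1 p2 :
                 {finite_measure set (d.-tuple R) -> \bar R},
     v = SOT sigma C1 p1 p2 + divergence phi1 p1 a + divergence phi2 p2 b].

End Defs.

(* Main.v *)
Require Import Defs.
From HB Require Import structures.
From mathcomp Require Import all_boot all_order all_algebra.
From mathcomp Require Import all_classical all_reals all_analysis.
From mathcomp Require Import measurable_realfun.
From mathcomp Require Import ring lra.
Import numFieldNormedType.Exports.
Import Order.TTheory GRing.Theory Num.Theory.
Local Open Scope classical_set_scope.
Local Open Scope ring_scope.

Set Implicit Arguments.
Unset Strict Implicit.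
Unset Printing Implicit Defensive.

(** Pushing marginals forward decreases divergences (data processing), so any
    coupling of the projections of [p1] and [p2] gives, for every [theta],
    [UOT <= OT + c] where [c] is the sum of the divergences of [p1] and [p2];
    integrate over the sphere.  Data processing holds because an entropy
    function is a countable supremum of affine functions [s x + t] and its
    recession constant is the supremum of the slopes [s]: the divergence
    dominates [s mu(B) + t nu(B)] on each cell [B] of any partition, and cells of
    the target pull back to cells of the source.

    Since entropy functions may take negative values, [c] may be negative, and
    then integrating [OT + c] requires [theta |-> OT] to be measurable up to a
    null set.  For a merely Borel cost this comes from the measurable projection
    theorem: finite measures on the plane are laws of functions coded by points
    [w] of the Baire space, [OT < t] says that some [w] satisfies a
    product-measurable condition on [(theta, w)], and projections of such sets
    are Suslin, hence measurable up to a null set by Choquet's capacitability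
    argument. *)

(** * Suslin sets and measurable projections *)

Lemma inv_natS_le (R : realType) (e : R) : 0 < e -> exists n, n.+1%:R^-1 <= e.
Proof.
move=> e0; have [n _ /(_ n (leqnn n)) /ltW] := near_infty_natSinv_lt (PosNum e0).
by exists n.
Qed.

Section greedy_branch.
Variable f : seq nat -> nat.

(** Prefixes of one infinite sequence whose next entry [f] chooses from the entries so far. *)
Definition greedy (m : nat) : seq nat := iter m (fun s => rcons s (f s)) [::].

Lemma size_greedy m : size (greedy m) = m.
Proof. by elim: m => //= m IH; rewrite size_rcons IH. Qed.

Lemma nth_greedy m i : (i < m)%N -> nth 0%N (greedy m) i = f (greedy i).
Proof.
elim: m => //= m IH; rewrite ltnS leq_eqVlt nth_rcons size_greedy.
by case/orP => [/eqP ->|im]; [rewrite ltnn eqxx|rewrite im IH].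
Qed.

Lemma greedy_ind (P : seq nat -> Prop) : P [::] ->
  (forall s, P s -> P (rcons s (f s))) -> forall m, P (greedy m).
Proof. by move=> P0 PS; elim => //= m IH; exact: PS. Qed.

End greedy_branch.

(** A prefix is good when at every level it extends to a bounded sequence satisfying [W]. Only
    finitely many values are allowed for the next entry, so one of them keeps the prefix good, and
    the greedy choice yields the sequence. *)
Lemma koenig_bounded (b : nat -> nat) (W : nat -> (nat -> nat) -> Prop) :
  (forall m x, W m.+1 x -> W m x) ->
  (forall m x y, (forall i, (i < m)%N -> x i = y i) -> W m x -> W m y) ->
  (forall m, exists x, (forall i, (i < m)%N -> (x i <= b i)%N) /\ W m x) ->
  exists x, forall m, W m x.
Proof.
move=> Wdec Wloc Wex.
have {}Wdec m n x : (m <= n)%N -> W n x -> W m x.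
  move=> /subnK <-; elim: (n - m)%N => // k IH.
  by rewrite addSn => /Wdec.
pose good (s : seq nat) := forall m, exists x,
  [/\ forall i, (i < m)%N -> (x i <= b i)%N, W m x &
      forall i, (i < size s)%N -> x i = nth 0%N s i].
have good0 : good [::] by move=> m; have [x [xb Wx]] := Wex m; exists x.
have goodS s : exists k, good s -> good (rcons s k).
  apply: contrapT => /forallNP bad.
  have gs : good s by apply: contrapT => ngs; apply: (bad 0%N).
  have /choice[m mP] : forall k, exists m, ~ exists x,
      [/\ forall i, (i < m)%N -> (x i <= b i)%N, W m x &
      forall i, (i < size (rcons s k))%N -> x i = nth 0%N (rcons s k) i].
    by move=> k; apply/existsNP => gk; apply: (bad k).
  (* At least every level at which an allowed next entry fails, and larger than [size s] so that the
     next entry of [x] is bounded. *)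
  pose M := maxn (size s).+1 (\max_(k < (b (size s)).+1) m k).
  have [x [xb Wx xs]] := gs M.
  have xk : (x (size s) <= b (size s))%N by apply: xb; rewrite leq_maxl.
  have mM : (m (x (size s)) <= M)%N.
    apply: leq_trans (leq_maxr _ _).
    exact: (leq_bigmax (Ordinal (n := (b (size s)).+1) xk)).
  apply: (mP (x (size s))); exists x; split.
  - by move=> i im; apply: xb; apply: leq_trans im mM.
  - exact: Wdec Wx.
  - move=> i; rewrite size_rcons ltnS leq_eqVlt nth_rcons.
    by case/orP => [/eqP ->|is_]; [rewrite ltnn eqxx|rewrite is_ xs].
have /choice[f fP] := goodS.
have gg := greedy_ind good0 fP.
exists (fun i => f (greedy f i)) => m.
have [y [_ Wy ys]] := gg m m.
apply: Wloc Wy => i im.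
by rewrite ys ?size_greedy// nth_greedy.
Qed.

Section capacitability.
Context d (T : measurableType d) (R : realType).
Variable mu : {measure set T -> \bar R}.
Hypothesis mu_fin : (mu setT < +oo)%E.
Local Open Scope ereal_scope.

(** The outer measure attached to [mu]. *)
Definition hull_mass (E : set T) : \bar R :=
  ereal_inf [set mu B | B in [set B | measurable B /\ E `<=` B]].

Lemma hull_mass_le E B : measurable B -> E `<=` B -> hull_mass E <= mu B.
Proof. by move=> mB EB; apply: ereal_inf_lbound; exists B. Qed.

Lemma le_hull_mass E F : E `<=` F -> hull_mass E <= hull_mass F.
Proof.
move=> EF; apply: le_ereal_inf => _ [B [mB FB] <-]; exists B => //.
by split => //; exact: subset_trans FB.
Qed.

Lemma hull_mass_ge0 E : 0 <= hull_mass E.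
Proof. by apply: le_ereal_inf_tmp => _ [B _ <-]. Qed.

Lemma measure_lty (A : set T) : measurable A -> mu A < +oo.
Proof.
by move=> mA; apply: le_lt_trans mu_fin; apply: le_measure; rewrite ?inE.
Qed.

Lemma hull_mass_fin E : hull_mass E \is a fin_num.
Proof.
rewrite ge0_fin_numE ?hull_mass_ge0//; apply: le_lt_trans mu_fin.
exact: hull_mass_le.
Qed.

(** Intersecting measurable supersets whose masses exceed the infimum by less than [1/(n+1)] attains
    it. *)
Lemma hull_ex E : exists B, [/\ measurable B, E `<=` B & mu B = hull_mass E].
Proof.
have /choice[B BP] : forall n, exists B, [/\ measurable B, E `<=` B &
    mu B < hull_mass E + n.+1%:R^-1%:E].
  move=> n; have n0 : (0 < n.+1%:R^-1 :> R)%R by rewrite invr_gt0.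
  have [_ [B [mB EB] <-] Bl] := lb_ereal_inf_adherent n0 (hull_mass_fin E).
  by exists B.
have mB : measurable (\bigcap_n B n).
  by apply: bigcap_measurable => // n _; have [] := BP n.
exists (\bigcap_n B n); split => //.
  by move=> x Ex n _; have [_ + _] := BP n; exact.
apply/eqP; rewrite eq_le; apply/andP; split; last first.
  apply: hull_mass_le => // x Ex n _; have [_ + _] := BP n; exact.
apply/lee_addgt0Pr => e e0.
have [n ne] := inv_natS_le e0.
have [mBn _ Bn] := BP n.
apply: (@le_trans _ _ (mu (B n))).
  by apply: le_measure; rewrite ?inE//; exact: bigcap_inf.
by apply: le_trans (ltW Bn) _; rewrite leeD2l// lee_fin.
Qed.

(** Measurable hulls [B n] of [E n] need not increase, but the intersections [C n] of the hulls from
    [n] on do; they contain [E n] and have mass at most [t], so continuity of [mu] from below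
    applies. *)
Lemma hull_mass_bigcup (E : nat -> set T) (t : \bar R) :
  (forall n, E n `<=` E n.+1) -> t < hull_mass (\bigcup_n E n) ->
  exists n, t < hull_mass (E n).
Proof.
move=> Ei tE; apply: contrapT => /forallNP H.
have {}H n : hull_mass (E n) <= t by rewrite leNgt; apply/negP.
have /choice[B BP] := fun n => hull_ex (E n).
have Einc m n : (m <= n)%N -> E m `<=` E n.
  move=> /subnK <-; elim: (n - m)%N => // k IH.
  by rewrite addSn; apply: subset_trans IH _; exact: Ei.
pose C n := \bigcap_(m in [set m | (n <= m)%N]) B m.
have mC n : measurable (C n).
  by apply: bigcap_measurable => [|m _]; [exists n => /=|have [] := BP m].
have muC n : mu (C n) <= t.
  apply: le_trans (H n); have [mBn _ <-] := BP n.
  by apply: le_measure; rewrite ?inE//; apply: bigcap_inf => /=.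
have Cnd : nondecreasing_seq C.
  move=> m n mn; apply/subsetPset => x Cx k /= nk.
  by apply: Cx => /=; exact: leq_trans nk.
have mUC : measurable (\bigcup_n C n) by apply: bigcup_measurable.
have cvC := @nondecreasing_cvg_mu _ _ _ mu _ mC mUC Cnd.
have : mu (\bigcup_n C n) <= t.
  rewrite -(cvg_lim _ cvC)//; apply: lime_le; first by apply/cvg_ex; eexists; exact: cvC.
  by apply: nearW => n; exact: muC.
apply/negP; rewrite -ltNge; apply: lt_le_trans tE _.
apply: hull_mass_le => // x [n _ Enx]; exists n => // m /= nm.
by have [_ + _] := BP m; apply; exact: Einc Enx.
Qed.

(** The Suslin operation over branches [x]. Each [K n] may read any finite number of coordinates,
    which leaves room for recoding branches in countable unions and intersections. *)
Definition suslin (E : set T) := exists K : nat -> (nat -> nat) -> set T,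
  [/\ forall n x, measurable (K n x),
      forall n, exists N, forall x y, (forall i, (i < N)%N -> x i = y i) ->
        K n x = K n y &
      E = [set w | exists x, forall n, K n x w]].

(* Bounding the coordinates of the branch [x] one at a time keeps the hull mass
   above [t], as hull mass is continuous along increasing unions; the branches
   below the resulting bound [b] form a compact set, and Koenig's lemma turns the
   corresponding part of [E] into a decreasing intersection of measurable sets. *)
Lemma suslin_inner (E : set T) (t : \bar R) : suslin E -> t < hull_mass E ->
  exists B, [/\ measurable B, B `<=` E & t <= mu B].
Proof.
move=> [K [mK /choice[N KN] EE]] tE.
pose D (s : seq nat) := [set w | exists x,
  (forall i, (i < size s)%N -> (x i <= nth 0%N s i)%N) /\ forall n, K n x w].
have D0 : t < hull_mass (D [::]).
  apply: lt_le_trans tE _; apply: le_hull_mass; rewrite EE => w [x Kx].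
  by exists x.
have DS s : exists k, t < hull_mass (D s) -> t < hull_mass (D (rcons s k)).
  have [tD|ntD] := pselect (t < hull_mass (D s)); last by exists 0%N.
  have [||k tk] := @hull_mass_bigcup (fun k => D (rcons s k)) t.
  - move=> k w [x [xb Kx]]; exists x; split => // i.
    move/(_ i): xb; rewrite !size_rcons !nth_rcons => xb iS.
    apply: leq_trans (xb iS) _; case: ifP => // _; case: ifP => // _.
  - apply: lt_le_trans tD _; apply: le_hull_mass => w [x [xb Kx]].
    exists (x (size s)) => //; exists x; split => // i.
    rewrite size_rcons ltnS leq_eqVlt nth_rcons.
    by case/orP => [/eqP ->|is_]; [rewrite ltnn eqxx|rewrite is_ xb].
  by exists k.
have /choice[f fP] := DS.
have DG := greedy_ind D0 fP.
pose b i := f (greedy f i).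
pose W w m x := forall n, (N n <= m)%N -> K n x w.
pose L m := [set w | exists x, (forall i, (i < m)%N -> (x i <= b i)%N) /\ W w m x].
have Wloc w m x y : (forall i, (i < m)%N -> x i = y i) -> W w m x -> W w m y.
  move=> xy Wx n nm; rewrite -(KN n x y); first exact: Wx.
  by move=> i iN; apply: xy; exact: leq_trans nm.
have mL m : measurable (L m).
  have -> : L m = \bigcup_(s in [set s : seq nat | forall i, (i < m)%N -> (nth 0%N s i <= b i)%N])
      \bigcap_(n in [set n | (N n <= m)%N]) K n (nth 0%N s).
    apply/seteqP; split => w.
      move=> [x [xb Wx]]; have nx i : (i < m)%N -> nth 0%N (mkseq x m) i = x i.
        by move=> im; rewrite nth_mkseq.
      exists (mkseq x m) => /=; first by move=> i im; rewrite nx// xb.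
      by move=> n /= nm; apply: (Wloc _ _ x) nm => // i im; rewrite nx.
    by move=> [s /= sb Ks]; exists (nth 0%N s); split => // n nm; exact: Ks.
  rewrite bigcup_mkcond; apply: countable_bigcupT_measurable; first exact: countableP.
  by move=> s; case: ifP => // _; apply: bigcap_measurableType.
have Ldec : nonincreasing_seq L.
  move=> m n mn; apply/subsetPset => w [x [xb Wx]]; exists x; split.
    by move=> i im; apply: xb; exact: leq_trans mn.
  by move=> k km; apply: Wx; exact: leq_trans mn.
exists (\bigcap_m L m); split; first exact: bigcap_measurable.
  move=> w Lw; rewrite EE /=.
  have [|||x Wx] := @koenig_bounded b (W w).
  - by move=> m x Wx n nm; apply: Wx; exact: leqW.
  - exact: Wloc.
  - by move=> m; exact: Lw.
  by exists x => n; apply: (Wx (N n)).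
have mIL : measurable (\bigcap_m L m) by exact: bigcap_measurable.
have cvL := @nonincreasing_cvg_mu _ _ _ mu _ (measure_lty (mL 0%N)) mL mIL Ldec.
rewrite -(cvg_lim _ cvL)//; apply: lime_ge; first by apply/cvg_ex; eexists; exact: cvL.
apply: nearW => m /=; apply: le_trans (ltW (DG m)) _; apply: hull_mass_le => //.
move=> w [x []]; rewrite size_greedy => xb Kx; exists x; split => //.
by move=> i im; move: (xb _ im); rewrite nth_greedy.
Qed.

(** A measurable hull gives [B2]; inner approximations of mass at least [hull_mass E - 1/(n+1)] have
    a union [B1] of the same mass, and finiteness makes the difference null. *)
Lemma suslin_sandwich (E : set T) : suslin E -> exists B1 B2,
  [/\ measurable B1, measurable B2, B1 `<=` E, E `<=` B2 & mu (B2 `\` B1) = 0].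
Proof.
move=> SE; have [B2 [mB2 EB2 muB2]] := hull_ex E.
have /choice[B BP] : forall n, exists B, [/\ measurable B, B `<=` E &
    hull_mass E - n.+1%:R^-1%:E <= mu B].
  move=> n; apply: suslin_inner => //.
  by rewrite lteBlDr// lteDl ?hull_mass_fin// lte_fin invr_gt0.
have mB1 : measurable (\bigcup_n B n).
  by apply: bigcup_measurable => // n _; have [] := BP n.
have B1E : \bigcup_n B n `<=` E by move=> w [n _]; have [_ + _] := BP n; exact.
exists (\bigcup_n B n), B2; split => //.
apply/eqP; rewrite eq_le measure_ge0 andbT.
rewrite measureD//; last exact: measure_lty.
rewrite setIidr; last exact: subset_trans EB2.
rewrite leeBlDr ?ge0_fin_numE ?measure_lty// add0e.
rewrite -[leLHS]/(mu B2) muB2.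
apply/lee_addgt0Pr => e e0.
have [n ne] := inv_natS_le e0.
have [mBn _ Bn] := BP n.
apply: (@le_trans _ _ (mu (B n) + n.+1%:R^-1%:E)); first by rewrite -leeBlDr.
apply: leeD; last by rewrite lee_fin.
by apply: le_measure; rewrite ?inE//; exact: bigcup_sup.
Qed.

End capacitability.

(** * The Baire space and projections along it *)

Definition cylinders : set (set (nat -> nat)) :=
  [set A | exists i k, A = [set w | w i = k]].

Definition baire := g_sigma_algebraType cylinders.
HB.instance Definition _ := Measurable.on baire.

Lemma measurable_cylinder i k : measurable [set w : baire | w i = k].
Proof. by apply: sub_sigma_algebra; exists i, k. Qed.

Definition nat_pair (n m : nat) : nat := pickle (n, m).
Definition nat_unpair (n : nat) : nat * nat := odflt (0%N, 0%N) (unpickle n).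

Lemma nat_pairK n m : nat_unpair (nat_pair n m) = (n, m).
Proof. by rewrite /nat_unpair /nat_pair pickleK. Qed.

Section product_suslin.
Context d (T : measurableType d).

(** The point [w] stays a parameter on the same footing as the branch [x], so that projecting along
    [w] only merges it into the branch. *)
Definition product_suslin (P : set (T * baire)) :=
  exists K : nat -> (nat -> nat) -> (nat -> nat) -> set T,
  [/\ forall n w x, measurable (K n w x),
      forall n, exists N, forall w x w' x',
        (forall i, (i < N)%N -> w i = w' i) ->
        (forall i, (i < N)%N -> x i = x' i) -> K n w x = K n w' x' &
      forall t w, P (t, w) <-> exists x, forall n, K n w x t].

Lemma product_suslin_bigcup (P : nat -> set (T * baire)) :
  (forall j, product_suslin (P j)) -> product_suslin (\bigcup_j P j).
Proof.
move=> /choice[K KP].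
(* The first coordinate of [x] selects [j], and the constraints attached to the
   other indices are vacuous: each [K' n] then depends on boundedly many
   coordinates. *)
pose K' n w (x : nat -> nat) :=
  if x 0%N == (nat_unpair n).1 then
    K (nat_unpair n).1 (nat_unpair n).2 w (fun i => x i.+1) else setT.
exists K'; split.
- move=> n w x; rewrite /K'; case: ifP => // _.
  by have [+ _ _] := KP (nat_unpair n).1; exact.
- move=> n; have [_ /(_ (nat_unpair n).2)[N KN] _] := KP (nat_unpair n).1.
  exists N.+1 => w x w' x' ww' xx'; rewrite /K' xx'//; case: ifP => // _.
  by apply: KN => [i iN|i iN]; [apply: ww'; exact: ltnW|exact: xx'].
- move=> t w; split.
    move=> [j _]; have [_ _ KE] := KP j; move=> /KE[x Kx].
    exists (fun i => if i is i'.+1 then x i' else j) => n; rewrite /K' /=.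
    by case: eqP => // <-.
  move=> [x Kx]; exists (x 0%N) => //; have [_ _ KE] := KP (x 0%N); apply/KE.
  exists (fun i => x i.+1) => n.
  by move: (Kx (nat_pair (x 0%N) n)); rewrite /K' nat_pairK/= eqxx.
Qed.

(** One sequence [x] holds a branch for each [j], spread out by the pairing of naturals; [K' n]
    tests one condition of one index, hence reads finitely many coordinates. *)
Lemma product_suslin_bigcap (P : nat -> set (T * baire)) :
  (forall j, product_suslin (P j)) -> product_suslin (\bigcap_j P j).
Proof.
move=> /choice[K KP].
pose K' n w (x : nat -> nat) :=
  K (nat_unpair n).1 (nat_unpair n).2 w (fun i => x (nat_pair (nat_unpair n).1 i)).
exists K'; split.
- by move=> n w x; have [+ _ _] := KP (nat_unpair n).1; exact.
- move=> n; have [_ /(_ (nat_unpair n).2)[N KN] _] := KP (nat_unpair n).1.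
  exists (maxn N (\max_(i < N) (nat_pair (nat_unpair n).1 i).+1)).
  move=> w x w' x' ww' xx'; apply: KN => i iN.
    by apply: ww'; apply: leq_trans (leq_maxl _ _).
  apply: xx'; apply: leq_trans (leq_maxr _ _).
  exact: (leq_bigmax (F := fun i : 'I_N => (nat_pair (nat_unpair n).1 i).+1) (Ordinal iN)).
- move=> t w; split.
    move=> Pt; have /choice[x xP] : forall j, exists x, forall n, K j n w x t.
      by move=> j; have [_ _ KE] := KP j; apply/KE; exact: Pt.
    exists (fun i => x (nat_unpair i).1 (nat_unpair i).2) => n; rewrite /K'.
    rewrite (_ : (fun i => _) = x (nat_unpair n).1)//.
    by apply/funext => i; rewrite nat_pairK.
  move=> [x Kx] j _; have [_ _ KE] := KP j; apply/KE.
  exists (fun i => x (nat_pair j i)) => n.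
  by move: (Kx (nat_pair j n)); rewrite /K' nat_pairK.
Qed.

Lemma product_suslin_fst (B : set T) : measurable B ->
  product_suslin (fst @^-1` B).
Proof.
move=> mB; exists (fun _ _ _ => B); split => //; first by move=> n; exists 0%N.
by move=> t w; split => [Bt|[x /(_ 0%N)]//]; exists point.
Qed.

Lemma product_suslin_coord (p : nat -> bool) i :
  product_suslin [set z | p (z.2 i)].
Proof.
exists (fun _ w _ => if p (w i) then setT else set0); split.
- by move=> _ w _; case: ifP.
- by move=> _; exists i.+1 => w x w' x' ->.
- move=> t w /=; split => [->|[x /(_ 0%N)]]; first by exists point.
  by case: ifP.
Qed.

(** Suslin sets need not be stable under complement, so the sigma-algebra argument runs on the sets
    that are Suslin together with their complement. *)
Lemma measurable_product_suslin (P : set (T * baire)) :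
  measurable P -> product_suslin P.
Proof.
pose C := [set A | product_suslin A /\ product_suslin (~` A)].
have C0 : C set0.
  split; first by rewrite -(preimage_set0 fst); exact: product_suslin_fst.
  by rewrite setC0 -(preimage_setT fst); exact: product_suslin_fst.
have sC : sigma_algebra setT C.
  split => //.
  - by move=> A [SA SCA]; split; rewrite setTD// setCK.
  - move=> F FC; split.
      by apply: product_suslin_bigcup => j; have [] := FC j.
    by rewrite setC_bigcup; apply: product_suslin_bigcap => j; have [] := FC j.
suff mC : measurable `<=` C by move=> /mC[].
apply: smallest_sub => //; rewrite subUset; split.
  move=> _ [B mB <-]; rewrite setTI; split; first exact: product_suslin_fst.
  by rewrite preimage_setC; apply: product_suslin_fst; exact: measurableC.
have sC2 : sigma_algebra setT [set B : set (nat -> nat) | C (snd @^-1` B)].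
  have [_ CC CU] := sC; split.
  - by rewrite /= preimage_set0.
  - move=> A /= /CC; by rewrite !setTD -preimage_setC.
  - by move=> F /= FC; rewrite preimage_bigcup; exact: CU.
move=> _ [B mB <-]; rewrite setTI; move: B mB.
apply: smallest_sub => // _ [i [k ->]]; split.
  have -> : snd @^-1` [set w : nat -> nat | w i = k] =
      [set z : T * baire | (pred1 k) (z.2 i)].
    by apply/seteqP; split => z /= /eqP.
  exact: (product_suslin_coord (pred1 k)).
have -> : ~` (snd @^-1` [set w : nat -> nat | w i = k]) =
    [set z : T * baire | (predC1 k) (z.2 i)].
  by apply/seteqP; split => z /= /eqP.
exact: (product_suslin_coord (predC1 k)).
Qed.

(** The new branch stores [w] at its even positions and [x] at its odd ones. *)
Lemma suslin_proj (P : set (T * baire)) :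
  product_suslin P -> suslin [set t | exists w, P (t, w)].
Proof.
move=> [K [mK KN KE]].
pose ev (z : nat -> nat) i := z i.*2.
pose od (z : nat -> nat) i := z i.*2.+1.
exists (fun n z => K n (ev z) (od z)); split => //.
- move=> n; have [N KNn] := KN n; exists N.*2 => x y xy.
  by apply: KNn => i iN; apply: xy; rewrite ?ltn_double// -doubleS leq_double.
- apply/seteqP; split => t /=.
    move=> [w /KE[x Kx]].
    pose z i := if odd i then x i./2 else w i./2.
    have evz : ev z = w by apply/funext => i; rewrite /ev /z odd_double doubleK.
    have odz : od z = x.
      by apply/funext => i; rewrite /od /z /= odd_double uphalf_double.
    by exists z => n; rewrite evz odz.
  by move=> [z Kz]; exists (ev z); apply/KE; exists (od z).
Qed.

End product_suslin.

Lemma measurable_projection d (T : measurableType d) (R : realType)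
    (mu : {measure set T -> \bar R}) (P : set (T * baire)) :
  (mu setT < +oo)%E -> measurable P -> exists B1 B2,
  [/\ measurable B1, measurable B2, B1 `<=` [set t | exists w, P (t, w)],
      [set t | exists w, P (t, w)] `<=` B2 & mu (B2 `\` B1) = 0%E].
Proof.
move=> mufin mP; apply: suslin_sandwich => //.
by apply: suslin_proj; exact: measurable_product_suslin.
Qed.

(** * Coding of the finite measures on the plane *)

Definition rev_prefix (v : nat -> nat) (n : nat) : seq nat :=
  iteri n (fun i s => v i :: s) [::].

Lemma size_rev_prefix v n : size (rev_prefix v n) = n.
Proof. by elim: n => //= n ->. Qed.

Lemma drop_rev_prefix v n k : drop k (rev_prefix v (k + n)) = rev_prefix v n.
Proof. by elim: k => //=; rewrite drop0. Qed.

Lemma nth_rev_prefix v n : nth 0%N (rev_prefix v n.+1) 0 = v n.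
Proof. by []. Qed.

Definition prefix_sets : set (set (nat -> nat)) :=
  [set A | exists n s, A = [set v | rev_prefix v n = s]].

Lemma measurable_prefix_set n s : measurable [set v : baire | rev_prefix v n = s].
Proof.
elim: n s => [|n IH] [|a s] /=.
- by rewrite (_ : [set _ | _] = setT)//; apply/seteqP; split.
- by rewrite (_ : [set _ | _] = set0)//; apply/seteqP; split.
- by rewrite (_ : [set _ | _] = set0)//; apply/seteqP; split.
- rewrite (_ : [set _ | _] = [set v | v n = a] `&` [set v | rev_prefix v n = s]).
    by apply: measurableI; [exact: measurable_cylinder|exact: IH].
  by apply/seteqP; split => v /= [-> ->].
Qed.

(** Prefix sets, unlike conditions on a single coordinate, are stable under intersection, as
    uniqueness of measures requires; a cylinder is a countable union of them. *)
Lemma baire_prefix_generated : @measurable _ baire = <<s prefix_sets >>.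
Proof.
apply/seteqP; split; apply: smallest_sub; try exact: smallest_sigma_algebra.
  move=> _ [i [k ->]].
  rewrite (_ : [set w | w i = k] =
      \bigcup_s (if nth 0%N s 0 == k then [set v | rev_prefix v i.+1 = s] else set0)).
    apply: (@countable_bigcupT_measurable _
      (g_sigma_algebraType prefix_sets) (seq nat)); first exact: countableP.
    move=> s; case: ifP => // _.
    by apply: sub_sigma_algebra; exists i.+1, s.
  apply/seteqP; split => v /=.
    by move=> vk; exists (rev_prefix v i.+1) => //; rewrite nth_rev_prefix vk eqxx.
  by move=> [s _]; case: ifP => // /eqP <- /= <-.
by move=> _ [n [s ->]]; exact: measurable_prefix_set.
Qed.

Lemma prefix_setsI : setI_closed prefix_sets.
Proof.
have H n m s t : (n <= m)%N -> prefix_sets ([set v | rev_prefix v n = s] `&`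
    [set v | rev_prefix v m = t]).
  move=> nm; have [e|e] := eqVneq (drop (m - n) t) s.
    exists m, t; apply/seteqP; split => v /=; first by case.
    by move=> vt; split => //; rewrite -e -vt -{2}(subnK nm) drop_rev_prefix.
  (* Incompatible prefixes: this encodes the empty set, as a prefix of length 0 is never a nonempty
     sequence. *)
  exists 0%N, [:: 0%N]; apply/seteqP; split => v //= -[vs vt].
  by move: e; rewrite -vs -vt -{2}(subnK nm) drop_rev_prefix eqxx.
move=> _ _ [n [s ->]] [m [t ->]]; have [nm|/ltnW mn] := leqP n m; first exact: H.
by rewrite setIC; exact: H.
Qed.

Lemma baire_measure_unique (R : realType) (m1 m2 : {measure set baire -> \bar R}) :
  (m1 setT < +oo)%E ->
  (forall n s, m1 [set v | rev_prefix v n = s] = m2 [set v | rev_prefix v n = s]) ->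
  forall A, measurable A -> m1 A = m2 A.
Proof.
move=> m1fin m12 A mA.
apply: (@measure_unique _ R baire prefix_sets (fun=> setT)
  baire_prefix_generated prefix_setsI _ _ m1 m2) => //.
- by move=> _; exists 0%N, [::]; apply/seteqP; split.
- by rewrite bigcup_const.
- by move=> _ [n [s ->]]; exact: m12.
Qed.

Section rationals.
Variable R : realType.

Definition nth_rat (n : nat) : R := ratr (odflt 0 (unpickle n : option rat)).

Lemma nth_rat_dense (x y : R) : x < y -> exists n, x < nth_rat n < y.
Proof.
move=> /rat_in_itvoo[q]; rewrite in_itv /= => xqy.
by exists (pickle q); rewrite /nth_rat pickleK.
Qed.

End rationals.

Section coded_functions.
Variable R : realType.

(* The code [w] describes a tree of thresholds: from the node [s] the real [u]
   goes to the child [1] when it lies below a threshold, given through the set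
   of rationals below it, and to the child [0] otherwise. *)
Definition below (w : nat -> nat) (s : seq nat) (u : R) : Prop :=
  exists k, w (nat_pair (pickle s) k) = 1%N /\ u < nth_rat R k.

Definition branch (w : nat -> nat) (u : R) (n : nat) : seq nat :=
  iter n (fun s => (`[< below w s u >] : nat) :: s) [::].

Definition decode (z : (nat -> nat) * R) : baire :=
  fun n => `[< below z.1 (branch z.1 z.2 n) z.2 >] : nat.

Lemma rev_prefix_decode w u n : rev_prefix (decode (w, u)) n = branch w u n.
Proof. by elim: n => //= n ->. Qed.

(** The rational thresholds make this a countable union of rectangles, so measurability is joint in
    the code and the real. *)
Lemma measurable_below s : measurable [set z : baire * measurableTypeR R | below z.1 s z.2].
Proof.
rewrite (_ : [set _ | _] = \bigcup_k
    ([set w : baire | w (nat_pair (pickle s) k) = 1%N] `*` `]-oo, nth_rat R k[)).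
  apply: bigcup_measurable => k _; apply: measurableX; first exact: measurable_cylinder.
  exact: measurable_itv.
apply/seteqP; split => -[w u] /=.
  by move=> [k [wk uk]]; exists k => //; split => //=; rewrite in_itv.
by move=> [k _ [/= wk]]; rewrite in_itv /= => uk; exists k.
Qed.

Lemma measurable_branch n s :
  measurable [set z : baire * measurableTypeR R | branch z.1 z.2 n = s].
Proof.
elim: n s => [|n IH] [|a s] /=.
- by rewrite (_ : [set _ | _] = setT)//; apply/seteqP; split.
- by rewrite (_ : [set _ | _] = set0)//; apply/seteqP; split.
- by rewrite (_ : [set _ | _] = set0)//; apply/seteqP; split.
have mb := measurable_below s.
rewrite (_ : [set _ | _] = [set z | branch z.1 z.2 n = s] `&`
    (if a == 1%N then [set z | below z.1 s z.2] else
     if a == 0%N then ~` [set z | below z.1 s z.2] else set0)).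
  apply: measurableI; first exact: IH.
  by case: ifP => // _; case: ifP => // _; exact: measurableC.
apply/seteqP; split => -[w u] /=.
  by move=> [<- <-]; split => //; case: asboolP.
move=> [->]; case: eqP => [->|a1]; first by move=> b; rewrite asboolT.
by case: eqP => // ->; move=> b; rewrite asboolF.
Qed.

Lemma measurable_decode : measurable_fun setT (decode : baire * measurableTypeR R -> baire).
Proof.
apply: (measurability _ baire_prefix_generated) => _ [_ [n [s ->]] <-].
rewrite setTI (_ : _ @^-1` _ = [set z | branch z.1 z.2 n = s]).
  exact: measurable_branch.
by apply/seteqP; split => -[w u] /=; rewrite rev_prefix_decode.
Qed.

End coded_functions.

(** * Measures on bit sequences as laws of coded functions *)

Section law_coding.
Context (R : realType).
Variable m : {finite_measure set baire -> \bar R}.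
Hypothesis m_bits : forall i, m [set v | (1 < v i)%N] = 0%E.

Let M : R := fine (m setT).

Let mass (s : seq nat) : R := fine (m [set v | rev_prefix v (size s) = s]).

Let finm A : measurable A -> m A \is a fin_num.
Proof. by move=> mA; exact: fin_num_measure. Qed.

Let massE s : (mass s)%:E = m [set v | rev_prefix v (size s) = s].
Proof. by rewrite fineK// finm//; exact: measurable_prefix_set. Qed.

Let mass_ge0 s : 0 <= mass s.
Proof. by rewrite -lee_fin massE. Qed.

Let mbig i : measurable [set v : baire | (1 < v i)%N].
Proof.
rewrite (_ : [set _ | _] = ~` ([set v | v i = 0%N] `|` [set v | v i = 1%N])).
  by apply: measurableC; apply: measurableU; exact: measurable_cylinder.
apply/seteqP; split => v /=; first by move=> h [] e; rewrite e in h.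
by case: (v i) => [|[|k]]// h; exfalso; apply: h; [left|right].
Qed.

Let mass_split s : mass s = mass (1%N :: s) + mass (0%N :: s).
Proof.
apply: EFin_inj; rewrite EFinD !massE /=.
have ms a : measurable [set v : baire | v (size s) :: rev_prefix v (size s) = a :: s].
  exact: (@measurable_prefix_set (size s).+1 (a :: s)).
rewrite -measureU//; last first.
  by apply/seteqP; split => v //= -[[-> _] []].
apply/eqP; rewrite eq_le; apply/andP; split; last first.
  apply: le_measure; rewrite ?inE//.
  - exact: measurableU.
  - exact: measurable_prefix_set.
  - by move=> v /= [[_ ->]|[_ ->]].
set B := _ `|` _; have mB : measurable B by exact: measurableU.
apply: (@le_trans _ _ (m (B `|` [set v | (1 < v (size s))%N]))); last first.
  apply: le_trans (measureU2 _ _ _) _ => //; rewrite -[leRHS]adde0; apply: leeD => //.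
  by rewrite le_eqVlt; apply/orP; left; apply/eqP; exact: m_bits.
apply: le_measure; rewrite ?inE//.
- exact: measurable_prefix_set.
- exact: measurableU.
move=> v /= vs; rewrite /B /= vs.
by case: (v (size s)) => [|[|k]]; [left; right|left; left|right].
Qed.

Let mass_big a s : (1 < a)%N -> mass (a :: s) = 0.
Proof.
move=> a1; apply: EFin_inj; rewrite massE.
apply/eqP; rewrite eq_le measure_ge0 andbT.
apply: (@le_trans _ _ (m [set v | (1 < v (size s))%N])); last first.
  by rewrite le_eqVlt; apply/orP; left; apply/eqP; exact: m_bits.
apply: le_measure; rewrite ?inE//.
- exact: measurable_prefix_set.
by move=> v /= [-> _].
Qed.

(* With thresholds [left_end s + mass (1 :: s)], the node [s] receives exactly the
   interval [left_end s, left_end s + mass s[. *)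
Fixpoint left_end (s : seq nat) : R :=
  if s is a :: s' then
    left_end s' + (if a == 1%N then 0 else mass (1%N :: s'))
  else 0.

(** Marks the rationals at most the threshold of each node; a marked rational strictly above [u]
    exists exactly when [u] is strictly below the threshold. *)
Definition law_code : nat -> nat := fun i =>
  let s := odflt [::] (unpickle (nat_unpair i).1 : option (seq nat)) in
  if nth_rat R (nat_unpair i).2 <= left_end s + mass (1%N :: s) then 1%N else 0%N.

Lemma below_law_code s (u : R) :
  below law_code s u <-> u < left_end s + mass (1%N :: s).
Proof.
have codeE k : law_code (nat_pair (pickle s) k) =
    if nth_rat R k <= left_end s + mass (1%N :: s) then 1%N else 0%N.
  by rewrite /law_code nat_pairK [(_, _).1]/= [(_, _).2]/= pickleK.
rewrite /below; split.
  move=> [k []]; rewrite codeE.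
  by case: ifP => // qk _ uk; exact: lt_le_trans uk qk.
move=> /nth_rat_dense[k /andP[uk kl]]; exists k; split => //.
by rewrite codeE (ltW kl).
Qed.

Lemma left_end_ge0 s : 0 <= left_end s.
Proof. by elim: s => //= a s IH; apply: addr_ge0 => //; case: ifP. Qed.

Lemma right_end_le s : left_end s + mass s <= M.
Proof.
elim: s => [|a s IH] /=.
  by rewrite add0r le_eqVlt; apply/orP; left; apply/eqP; congr (fine (m _)); apply/seteqP; split.
apply: le_trans IH; rewrite -addrA lerD2l (mass_split s).
have [->|a1] := eqVneq a 1%N; first by rewrite add0r lerDl.
rewrite lerD2l; case: a a1 => [//|[//|a _]].
by rewrite mass_big.
Qed.

(** The interval of a node is cut in two: child 1 takes the left part, of length [mass (1 :: s)],
    and child 0 the remainder, by [mass_split]; larger children get empty intervals. *)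
Lemma branch_law_code (u : R) s : 0 <= u < M ->
  (branch law_code u (size s) = s) <-> (left_end s <= u < left_end s + mass s).
Proof.
move=> /andP[u0 uM]; elim: s => [|a s IH] /=.
  rewrite add0r u0 /= (_ : mass [::] = M) ?uM//.
  by congr (fine (m _)); apply/seteqP; split.
split.
  move=> [<- bs]; rewrite bs; case: asboolP => /=; rewrite below_law_code.
    by move=> ul; rewrite addr0 ul andbT; have [/(_ bs)/andP[]] := IH.
  move=> /negP; rewrite -leNgt => ->/=.
  by rewrite -addrA -mass_split; have [/(_ bs)/andP[]] := IH.
case: a => [|[|a]] /=; last first.
- by rewrite (@mass_big a.+2)// addr0 => /andP[/le_lt_trans h /h]; rewrite ltxx.
- rewrite addr0 => /andP[lu ur].
  have bs : branch law_code u (size s) = s.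
    apply/IH; rewrite lu /=; apply: lt_le_trans ur _.
    by rewrite lerD2l (mass_split s) lerDl.
  by rewrite bs asboolT//; apply/below_law_code.
- rewrite -addrA -mass_split => /andP[lu ur].
  have bs : branch law_code u (size s) = s.
    apply/IH; rewrite ur andbT; apply: le_trans lu.
    by rewrite lerDl.
  by rewrite bs asboolF//; rewrite below_law_code; apply/negP; rewrite -leNgt.
Qed.

End law_coding.

Section finite_pushforward.
Context d1 d2 (T1 : measurableType d1) (T2 : measurableType d2) (R : realType).
Variables (m : {finite_measure set T1 -> \bar R}) (f : T1 -> T2).
Hypothesis mf : measurable_fun setT f.

Let map : set T2 -> \bar R := pushforward m f.

Let mpre A : measurable A -> measurable (f @^-1` A).
Proof. by move=> mA; rewrite -[X in measurable X]setTI; exact: mf. Qed.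

Let map0 : map set0 = 0%E. Proof. by rewrite /map /pushforward preimage_set0. Qed.

Let map_ge0 A : (0 <= map A)%E. Proof. exact: measure_ge0. Qed.

Let map_sigma_additive : semi_sigma_additive map.
Proof.
exact: (@measure_semi_sigma_additive _ _ _
  (measure_function_pushforward__canonical__measure_function_Measure m mf)).
Qed.

HB.instance Definition _ := isMeasure.Build _ _ _ map
  map0 map_ge0 map_sigma_additive.

Let map_fin : fin_num_fun map.
Proof. by move=> A mA; apply: fin_num_measure; exact: mpre. Qed.

HB.instance Definition _ := Measure_isFinite.Build _ _ _ map map_fin.

Definition finite_pushforward : {finite_measure set T2 -> \bar R} := map.

End finite_pushforward.

Section segment.
Variables (R : realType) (M : R).

Lemma segment_fin : (lebesgue_measure (`[0%R, M[ : set (measurableTypeR R)) < +oo)%E.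
Proof. by rewrite lebesgue_measure_itv /= lte_fin; case: ifP => //; rewrite ltry. Qed.

(** The common source of the coding: every finite measure of mass [M] on the plane is the law of a
    function on it. *)
Definition segment : {finite_measure set (measurableTypeR R) -> \bar R} :=
  mfrestr (measurable_itv `[0%R, M[ : measurable (`[0%R, M[ : set (measurableTypeR R)))
    segment_fin.

Lemma segmentE A : segment A = lebesgue_measure (A `&` `[0%R, M[).
Proof. by []. Qed.

End segment.

Lemma measurable_decode_section (R : realType) (w : baire) :
  measurable_fun setT (fun u : measurableTypeR R => decode (w, u)).
Proof.
apply: (measurableT_comp (@measurable_decode R)).
by apply: measurable_fun_pair.
Qed.

(** By [branch_law_code], the reals whose decoded bits start with [s] form an interval whose length
    is the mass of [s]; agreement on prefix sets determines the measure. *)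
Lemma law_code_decode (R : realType) (m : {finite_measure set baire -> \bar R}) :
  (forall i, m [set v | (1 < v i)%N] = 0%E) ->
  forall A : set baire, measurable A ->
  segment (fine (m setT)) ((fun u => decode (law_code m, u)) @^-1` A) = m A.
Proof.
move=> m_bits A mA; set M := fine (m setT); set g := fun u => _.
have mg : measurable_fun setT g by exact: measurable_decode_section.
have M0 : 0 <= M by rewrite fine_ge0.
change (finite_pushforward (segment M) mg A = m A).
apply: baire_measure_unique => //; first exact: fin_num_fun_lty.
move=> n s; change (segment M (g @^-1` [set v | rev_prefix v n = s]) = m [set v | rev_prefix v n = s]).
have [ns|ns] := eqVneq (size s) n; last first.
  have e0 : [set v | rev_prefix v n = s] = set0.
    by apply/seteqP; split => v //= vs; move: ns; rewrite -vs size_rev_prefix eqxx.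
  by rewrite e0 preimage_set0 !measure0.
subst n; rewrite segmentE.
have rM := right_end_le m_bits s.
have l0 := left_end_ge0 m s.
have ms : measurable [set v : baire | rev_prefix v (size s) = s] by exact: measurable_prefix_set.
set mass := fine (m [set v | rev_prefix v (size s) = s]) in rM.
have mass0 : 0 <= mass by rewrite fine_ge0.
rewrite (_ : _ `&` _ = `[left_end m s, left_end m s + mass[%classic).
  rewrite lebesgue_measure_itv /= lte_fin ltrDl; case: ifP => m0.
    by rewrite -EFinB addrAC subrr add0r fineK// fin_num_measure.
  rewrite -[RHS]fineK ?fin_num_measure//; congr EFin.
  by apply/eqP; rewrite eq_sym; move: m0; rewrite lt_neqAle mass0 andbT eq_sym => /negbFE.
apply/seteqP; split => u; rewrite /= !in_itv /= rev_prefix_decode.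
  by move=> [bs uM]; apply/(branch_law_code m_bits s uM).
move=> lur; have uM : 0 <= u < M.
  case/andP: lur => lu ur; rewrite (le_trans l0 lu) /=.
  exact: lt_le_trans ur rM.
by split => //; apply/(branch_law_code m_bits s uM).
Qed.

Section plane_coding.
Variable R : realType.

(** Bits of the Dedekind cuts of both coordinates, [b = 0] selecting the first one; [decode_line]
    recovers a coordinate as the infimum of the marked rationals. *)
Definition encode_plane (z : R * R) : baire := fun i =>
  let (b, n) := nat_unpair i in
  if (if b == 0%N then z.1 else z.2) < nth_rat R n then 1%N else 0%N.

Definition decode_line (b : nat) (v : baire) : R :=
  fine (einfs (fun n => if v (nat_pair b n) == 1%N then (nth_rat R n)%:E else +oo%E) 0%N).

Definition decode_plane (v : baire) : R * R := (decode_line 0 v, decode_line 1 v).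

Lemma measurable_decode_line b : measurable_fun setT (decode_line b).
Proof.
apply: (measurableT_comp (fine_measurable _)) => //.
apply: measurable_fun_einfs => n; apply: measurable_fun_ifT => //.
apply: (measurable_fun_bool true); rewrite setTI.
rewrite (_ : _ @^-1` _ = [set v : baire | v (nat_pair b n) = 1%N]).
  exact: measurable_cylinder.
by apply/seteqP; split => v /= /eqP.
Qed.

Lemma measurable_decode_plane : measurable_fun setT decode_plane.
Proof. by apply: measurable_fun_pair; exact: measurable_decode_line. Qed.

Lemma measurable_encode_plane : measurable_fun setT encode_plane.
Proof.
have mlt b n : measurable [set z : R * R | (if b == 0%N then z.1 else z.2) < nth_rat R n].
  rewrite (_ : [set _ | _] = (fun z : R * R => if b == 0%N then z.1 else z.2) @^-1` `]-oo, nth_rat R n[).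
    rewrite -[X in measurable X]setTI.
    by case: (b == 0%N); [apply: measurable_fst|apply: measurable_snd].
  by apply/seteqP; split => z /=; rewrite in_itv.
have mG : @measurable _ baire = <<s cylinders >> by [].
apply: (measurability _ mG) => _ [_ [i [k ->]] <-].
rewrite setTI /encode_plane; case E : (nat_unpair i) => [b n].
rewrite (_ : _ @^-1` _ =
  if k == 1%N then [set z : R * R | (if b == 0%N then z.1 else z.2) < nth_rat R n] else
  if k == 0%N then ~` [set z : R * R | (if b == 0%N then z.1 else z.2) < nth_rat R n] else set0).
  by case: ifP => // _; case: ifP => // _; exact: measurableC.
apply/seteqP; split => z /=; rewrite E.
  by case c : (_ < _) => <- /=; rewrite c.
by case: eqP => [->/= ->//|_]; case: eqP => [->/= /negP/negbTE ->//|_].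
Qed.

Lemma encode_planeK z : decode_plane (encode_plane z) = z.
Proof.
have H (x : R) : fine (einfs (fun n => if x < nth_rat R n then (nth_rat R n)%:E else +oo%E) 0%N) = x.
  rewrite /einfs /= (_ : ereal_inf _ = x%:E)//; apply/eqP; rewrite eq_le; apply/andP; split.
    apply/lee_addgt0Pr => e e0.
    have [n /andP[xn ne]] : exists n, x < nth_rat R n < x + e.
      by apply: nth_rat_dense; rewrite ltrDl.
    apply: (@le_trans _ _ (nth_rat R n)%:E); last by rewrite -EFinD lee_fin ltW.
    by apply: ereal_inf_lbound; exists n => //=; rewrite xn.
  by apply: le_ereal_inf_tmp => _ [n _ <-]; case: ifP; rewrite ?leey// lee_fin => /ltW.
rewrite /decode_plane /decode_line [RHS]surjective_pairing; congr (_, _).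
  rewrite -[RHS]H; congr (fine (einfs _ _)); apply/funext => n.
  by rewrite /encode_plane nat_pairK /=; case: (_ < _).
rewrite -[RHS]H; congr (fine (einfs _ _)); apply/funext => n.
by rewrite /encode_plane nat_pairK /=; case: (_ < _).
Qed.

Definition plane_of (z : baire * measurableTypeR R) : R * R := decode_plane (decode z).

Lemma measurable_plane_of : measurable_fun setT plane_of.
Proof. exact: (measurableT_comp measurable_decode_plane (@measurable_decode R)). Qed.

(** The image of [pi] under [encode_plane] lives on bit sequences, so [law_code] represents it;
    decoding the bits gives back [pi] by [encode_planeK]. *)
Lemma plane_law (pi : {finite_measure set (R * R)%type -> \bar R}) :
  exists w : baire, forall A, measurable A ->
  segment (fine (pi setT)) ((fun u => plane_of (w, u)) @^-1` A) = pi A.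
Proof.
have men := measurable_encode_plane.
pose m : {finite_measure set baire -> \bar R} := finite_pushforward pi men.
have mE A : m A = pi (encode_plane @^-1` A) by [].
have m_bits i : m [set v | (1 < v i)%N] = 0%E.
  rewrite mE (_ : _ @^-1` _ = set0) ?measure0//.
  by apply/seteqP; split => z //=; rewrite /encode_plane; case: nat_unpair => b n; case: ifP.
exists (law_code m) => A mA.
have mA' : measurable (decode_plane @^-1` A).
  by rewrite -[X in measurable X]setTI; exact: measurable_decode_plane.
have := law_code_decode m_bits mA'; rewrite !mE preimage_setT => ->.
by congr (pi _); apply/seteqP; split => z /=; rewrite encode_planeK.
Qed.

End plane_coding.

(** * Measurability of the transport cost *)

Lemma measurable_eqe d (T : measurableType d) (R : realType) (f g : T -> \bar R) :
  measurable_fun setT f -> measurable_fun setT g -> measurable [set x | f x = g x].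
Proof.
move=> mf mg.
rewrite (_ : [set x | _] = ~` ((setT `&` [set x | (f x < g x)%E]) `|`
    (setT `&` [set x | (g x < f x)%E]))).
  by apply: measurableC; apply: measurableU; exact: measurable_lte.
rewrite !setTI; apply/seteqP; split => x /=; first by move=> ->; rewrite ltxx => -[].
by move=> h; apply/eqP; apply: contrapT => /negP; rewrite neq_lt => /orP.
Qed.

(** Rational half-lines form a countable generating family stable under intersection, so prescribing
    a marginal amounts to countably many equalities, a measurable condition. *)
Lemma borel_measure_eq (R : realType) (m1 m2 : {finite_measure set R -> \bar R}) :
  (forall n, m1 `]-oo, nth_rat R n[%classic = m2 `]-oo, nth_rat R n[%classic) ->
  forall A, measurable A -> m1 A = m2 A.
Proof.
move=> m12 A mA.
pose G := [set A | exists n, A = `]-oo, nth_rat R n[%classic].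
have GE : (@measurable _ R) = <<s G >>.
  rewrite [LHS]RGenInftyO.measurableE; apply/seteqP; split.
    apply: smallest_sub; first exact: smallest_sigma_algebra.
    move=> _ [x ->].
    rewrite (_ : [set` _] = \bigcup_n
        (if nth_rat R n < x then `]-oo, nth_rat R n[%classic else set0)).
      apply: sigma_algebra_bigcup => n; case: ifP => _; last exact: sigma_algebra0.
      by apply: sub_sigma_algebra; exists n.
    apply/seteqP; split => y /=; rewrite in_itv /=.
      move=> /nth_rat_dense[n /andP[yn nx]]; exists n => //.
      by rewrite nx /= in_itv.
    by move=> [n _]; case: ifP => //= nx; rewrite in_itv /= => /lt_trans; exact.
  apply: smallest_sub; first exact: smallest_sigma_algebra.
  by move=> _ [n ->]; apply: sub_sigma_algebra; exists (nth_rat R n).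
have GI : setI_closed G.
  move=> _ _ [n ->] [m ->].
  have H i j : nth_rat R i <= nth_rat R j ->
      `]-oo, nth_rat R i[%classic `&` `]-oo, nth_rat R j[%classic = `]-oo, nth_rat R i[%classic.
    move=> ij; apply: setIidl => x /=; rewrite !in_itv /= => xi.
    exact: lt_le_trans ij.
  have [nm|/ltW mn] := leP (nth_rat R n) (nth_rat R m); first by exists n; rewrite H.
  by exists m; rewrite setIC H.
have /choice[g gP] : forall k : nat, exists n, k%:R < nth_rat R n.
  by move=> k; have [|n /andP[? _]] := @nth_rat_dense R k%:R (k%:R + 1); [rewrite ltrDl|exists n].
apply: (@measure_unique _ R R G (fun k => `]-oo, nth_rat R (g k)[%classic) GE GI _ _ m1 m2) => //.
- by move=> k; exists (g k).
- apply/seteqP; split => // x _; exists (Num.truncn `|x|).+1 => //=.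
  rewrite in_itv /=; apply: lt_trans (gP _); apply: le_lt_trans (ler_norm x) _.
  exact: truncnS_gt.
- by move=> _ [n ->]; exact: m12.
- by move=> k; rewrite ltey_eq fin_num_measure//; exact: measurable_itv.
Qed.

Section transport_measurability.
Context d (T : measurableType d) (R : realType).
Variables (mu : {measure set T -> \bar R}) (C1 : R * R -> \bar R).
Hypothesis mu_fin : (mu setT < +oo)%E.
Hypothesis mC1 : measurable_fun setT C1.
Hypothesis C1_ge0 : forall z, (0 <= C1 z)%E.
Variables (m1 m2 : T -> {finite_measure set R -> \bar R}) (M : R).
Hypothesis mm1 : forall A, measurable A -> measurable_fun setT (fun t => m1 t A).
Hypothesis mm2 : forall A, measurable A -> measurable_fun setT (fun t => m2 t A).
Hypothesis m1T : forall t, m1 t setT = M%:E.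

Let mplane (w : baire) : measurable_fun setT (fun u : measurableTypeR R => plane_of (w, u)).
Proof.
have mp : measurable_fun setT (fun u : measurableTypeR R => (w, u) : baire * measurableTypeR R).
  exact: measurable_fun_pair.
exact: (measurableT_comp (@measurable_plane_of R) mp).
Qed.

Let coded (w : baire) : {finite_measure set (R * R)%type -> \bar R} :=
  finite_pushforward (segment M) (@mplane w).

Let codedE w A : coded w A = segment M ((fun u => plane_of (w, u)) @^-1` A).
Proof. by []. Qed.

Let measurable_coded A : measurable A -> measurable_fun setT (fun w => coded w A).
Proof.
move=> mA.
have mA' : measurable (@plane_of R @^-1` A).
  by rewrite -[X in measurable X]setTI; exact: measurable_plane_of.
rewrite (_ : (fun w => _) = segment M \o xsection (@plane_of R @^-1` A)).
  exact: measurable_fun_xsection mA'.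
by apply/funext => w /=; rewrite /xsection codedE; congr (segment M _); apply/seteqP;
  split => u /=; rewrite in_setE.
Qed.

Let measurable_cost : measurable_fun setT (fun w => \int[coded w]_z C1 z)%E.
Proof.
rewrite (_ : (fun w => _) = (fun w : baire =>
    \int[segment M]_u C1 (plane_of (w, u)))%E).
  apply: (@measurable_fun_fubini_tonelli_F _ _ baire (measurableTypeR R) R
    (segment M) (C1 \o @plane_of R)) => //.
    exact: (measurableT_comp mC1 (@measurable_plane_of R)).
  by move=> z; exact: C1_ge0.
apply/funext => w; rewrite [LHS](ge0_integral_pushforward (@mplane w))//.
Qed.

Let graph (s : R) : set (T * baire) := [set z |
  [/\ forall n, coded z.2 (fst @^-1` `]-oo, nth_rat R n[) = m1 z.1 `]-oo, nth_rat R n[%classic,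
      forall n, coded z.2 (snd @^-1` `]-oo, nth_rat R n[) = m2 z.1 `]-oo, nth_rat R n[%classic &
      (\int[coded z.2]_z C1 z < s%:E)%E]].

Let mfst (A : set R) : measurable A -> measurable (@fst R R @^-1` A).
Proof. by move=> mA; rewrite -[X in measurable X]setTI; exact: measurable_fst. Qed.

Let msnd (A : set R) : measurable A -> measurable (@snd R R @^-1` A).
Proof. by move=> mA; rewrite -[X in measurable X]setTI; exact: measurable_snd. Qed.

Let measurable_graph s : measurable (graph s).
Proof.
rewrite (_ : graph s = (\bigcap_n
   [set z | coded z.2 (fst @^-1` `]-oo, nth_rat R n[) = m1 z.1 `]-oo, nth_rat R n[%classic]) `&`
   (\bigcap_n [set z | coded z.2 (snd @^-1` `]-oo, nth_rat R n[) = m2 z.1 `]-oo, nth_rat R n[%classic]) `&`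
   (setT `&` [set z | (\int[coded z.2]_z C1 z < s%:E)%E])).
  have mI n : measurable (`]-oo, nth_rat R n[%classic : set R) by exact: measurable_itv.
  apply: measurableI; last first.
    apply: emeasurable_fun_infty_o => //.
    exact: (measurableT_comp measurable_cost measurable_snd).
  apply: measurableI; apply: bigcap_measurableType => n _; apply: measurable_eqe.
  - exact: (measurableT_comp (measurable_coded (mfst (mI n))) measurable_snd).
  - exact: (measurableT_comp (mm1 (mI n)) measurable_fst).
  - exact: (measurableT_comp (measurable_coded (msnd (mI n))) measurable_snd).
  - exact: (measurableT_comp (mm2 (mI n)) measurable_fst).
apply/seteqP; split => z /=.
  move=> [h1 h2 h3]; split; last by split.
  by split => n _; [exact: h1|exact: h2].
by move=> [[h1 h2] [_ h3]]; split => // n; [exact: (h1 n)|exact: (h2 n)].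
Qed.

(** A coupling of cost below [s] has a code; its mass is that of its first marginal, namely [M], so
    one segment serves all [t]. Conversely, the values on rational half-lines determine the
    marginals of a coded measure. *)
Let OT_lt s : [set t | (OT C1 (m1 t) (m2 t) < s%:E)%E] = [set t | exists w, graph s (t, w)].
Proof.
apply/seteqP; split => t /=.
  move=> /ereal_inf_lt[_ [pi [pi1 pi2 ->]] pis].
  have piT : fine (pi setT) = M.
    by have /(congr1 fine) := pi1 _ measurableT; rewrite preimage_setT m1T.
  have [w wP] := plane_law pi.
  have {}wP A : measurable A -> coded w A = pi A by move=> mA; rewrite codedE -piT wP.
  exists w; rewrite /graph /=; split.
  - by move=> n; rewrite wP ?pi1//; apply: mfst; exact: measurable_itv.
  - by move=> n; rewrite wP ?pi2//; apply: msnd; exact: measurable_itv.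
  - by rewrite (eq_measure_integral pi)// => A mA _; exact: wP.
move=> [w [/= h1 h2 hs]]; apply: le_lt_trans hs; apply: ereal_inf_lbound.
exists (coded w); split => // A mA.
- exact: (@borel_measure_eq _ (finite_pushforward (coded w) measurable_fst)).
- exact: (@borel_measure_eq _ (finite_pushforward (coded w) measurable_snd)).
Qed.

Lemma OT_ge0 t : (0 <= OT C1 (m1 t) (m2 t))%E.
Proof. by apply: le_ereal_inf_tmp => _ [pi [_ _ ->]]; exact: integral_ge0. Qed.

(** Sublevel sets at rational levels are projections, hence lie between measurable sets with null
    difference. Each bound is the infimum of the levels whose set contains [t], and [N] collects the
    countably many differences. *)
Lemma OT_sandwich : exists (F1 F2 : T -> \bar R) (N : set T),
  [/\ measurable_fun setT F1, measurable_fun setT F2, measurable N, mu N = 0%E &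
      forall t, [/\ (0 <= F1 t)%E, (F1 t <= OT C1 (m1 t) (m2 t))%E,
                    (OT C1 (m1 t) (m2 t) <= F2 t)%E & ~ N t -> F1 t = F2 t]].
Proof.
have /choice[B1 /choice[B2 BP]] : forall n, exists B1 B2,
  [/\ measurable B1, measurable B2,
     B1 `<=` [set t | (OT C1 (m1 t) (m2 t) < (nth_rat R n)%:E)%E],
     [set t | (OT C1 (m1 t) (m2 t) < (nth_rat R n)%:E)%E] `<=` B2 & mu (B2 `\` B1) = 0%E].
  by move=> n; rewrite OT_lt; exact: measurable_projection.
have mB1 n : measurable (B1 n) by have [] := BP n.
have mB2 n : measurable (B2 n) by have [] := BP n.
have mN n : measurable (B2 n `\` B1 n) by exact: measurableD.
pose h (B : nat -> set T) n t := if t \in B n then (nth_rat R n)%:E else +oo%E.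
(* Larger sets give a smaller infimum, so [B2] yields the minorant and [B1] the majorant; the
   maximum with 0 keeps the minorant nonnegative even where some [B2 n] of negative level is
   nonempty. *)
pose H B t := maxe 0%E (einfs (h B ^~ t) 0%N).
have mH B : (forall n, measurable (B n)) -> measurable_fun setT (H B).
  move=> mB; apply: measurable_maxe => //; apply: measurable_fun_einfs => n.
  apply: measurable_fun_ifT => //; apply: (measurable_fun_bool true).
  by rewrite setTI (_ : _ @^-1` _ = B n)//; apply/seteqP; split => t /= => [/set_mem|/mem_set].
exists (H B2), (H B1), (\bigcup_n (B2 n `\` B1 n)); split.
- exact: mH.
- exact: mH.
- exact: bigcup_measurable.
- apply: measure_negligible; first exact: bigcup_measurable.
  by apply: negligible_bigcup => n; exists (B2 n `\` B1 n); split => //; have [] := BP n.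
move=> t; split.
- by rewrite /H le_max lexx.
- rewrite /H ge_max OT_ge0 /=.
  have := OT_ge0 t; case E : (OT C1 (m1 t) (m2 t)) => [r| |]// _; last by rewrite leey.
  apply/lee_addgt0Pr => e e0.
  have [n /andP[rn ne]] : exists n, r < nth_rat R n < r + e.
    by apply: nth_rat_dense; rewrite ltrDl.
  apply: (@le_trans _ _ (nth_rat R n)%:E); last by rewrite -EFinD lee_fin ltW.
  apply: ereal_inf_lbound; exists n => //=; rewrite /h ifT//.
  by rewrite in_setE; have [_ _ _ + _] := BP n; apply => /=; rewrite E lte_fin.
- rewrite /H le_max; apply/orP; right; apply: le_ereal_inf_tmp => _ [n _ <-].
  rewrite /h; case: ifPn => [|_]; last by rewrite leey.
  by rewrite in_setE => B1t; apply: ltW; have [_ _ + _ _] := BP n; apply.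
- move=> Nt; rewrite /H; congr (maxe _ (einfs _ _)); apply/funext => n.
  have [_ _ s1 s2 _] := BP n; rewrite /h; congr (if _ then _ else _).
  apply/idP/idP; rewrite !in_setE.
    by move=> B2t; apply: contrapT => nB1; apply: Nt; exists n.
  by move=> /s1 /s2.
Qed.

End transport_measurability.

(** * Entropy functions as suprema of affine functions *)

Section entropy_minorants.
Context (R : realType) (phi : R -> \bar R).
Hypothesis Hphi : entropy_function phi.

Let phiNy x : phi x != -oo%E. Proof. by case: Hphi => ->. Qed.

Lemma convex_three_points (p q r fp fr : R) : p < q < r ->
  phi p = fp%:E -> phi r = fr%:E ->
  (phi q <= ((fp * (r - q) + fr * (q - p)) / (r - p))%:E)%E.
Proof.
move=> /andP[pq qr] Ep Er; have [_ _ cvx _ _] := Hphi.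
have rp : 0 < r - p by rewrite subr_gt0 (lt_trans pq).
pose t := (r - q) / (r - p).
have t01 : 0 <= t <= 1.
  rewrite /t divr_ge0 ?(ltW rp) ?subr_ge0 ?(ltW qr)//=.
  by rewrite ler_pdivrMr// mul1r lerB// ltW.
have := cvx p r t t01; rewrite Ep Er -!EFinM -EFinD.
have -> : t * p + (1 - t) * r = q.
  by rewrite /t; field; rewrite gt_eqF.
move=> /le_trans; apply; rewrite lee_fin le_eqVlt; apply/orP; left; apply/eqP.
by rewrite /t; field; rewrite gt_eqF.
Qed.

Lemma phi_cases x : phi x = +oo%E \/ exists f, phi x = f%:E.
Proof. by case E : (phi x) (phiNy x) => [f| |]// _; [right; exists f|left]. Qed.

Lemma convex_right_line (p q fp fq x : R) : p < q -> q < x ->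
  phi p = fp%:E -> phi q = fq%:E ->
  ((fq + (fq - fp) / (q - p) * (x - q))%:E <= phi x)%E.
Proof.
move=> pq qx Ep Eq; have [->|[f Ex]] := phi_cases x; first by rewrite leey.
have := @convex_three_points p q x fp f _ Ep Ex; rewrite pq qx Eq => /(_ isT).
have qp : 0 < q - p by rewrite subr_gt0.
rewrite Ex !lee_fin ler_pdivlMr ?subr_gt0 ?(lt_trans pq)// => h.
rewrite -(ler_pM2r qp) mulrDl mulrAC divfK ?gt_eqF//.
lra.
Qed.

Lemma convex_left_line (p q fp fq x : R) : p < q -> x < p ->
  phi p = fp%:E -> phi q = fq%:E ->
  ((fp - (fq - fp) / (q - p) * (p - x))%:E <= phi x)%E.
Proof.
move=> pq xp Ep Eq; have [->|[f Ex]] := phi_cases x; first by rewrite leey.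
have := @convex_three_points x p q f fq _ Ex Eq; rewrite pq xp Ep => /(_ isT).
have qp : 0 < q - p by rewrite subr_gt0.
rewrite Ex !lee_fin ler_pdivlMr ?subr_gt0 ?(lt_trans xp)// => h.
rewrite -(ler_pM2r qp) mulrBl mulrAC divfK ?gt_eqF//.
lra.
Qed.

(** Take [c] midway between two points of the domain: the chord from either of them to [c],
    prolonged beyond [c], stays below [phi]. If 1 is the only point of the domain, the constant 0
    serves. *)
Lemma convex_cone_minorant : exists c f A : R, 0 <= A /\
  forall x, ((f - A * `|x - c|)%:E <= phi x)%E.
Proof.
have [_ _ _ _ phi1] := Hphi.
have [[z [z1 [fz Ez]]]|dom1] := pselect (exists z, z <> 1 /\ exists f, phi z = f%:E); last first.
  exists 1, 0, 0; split => // x; have [->|[f Ex]] := phi_cases x; first by rewrite leey.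
  have -> : x = 1 by apply: contrapT => x1; apply: dom1; exists x; split => //; exists f.
  by rewrite mul0r subr0 phi1.
have [p [q [fp [fq [pq Ep Eq]]]]] : exists p q fp fq, [/\ p < q, phi p = fp%:E & phi q = fq%:E].
  have [zl|zg|//] := ltgtP z 1; first by exists z, 1, fz, 0.
  by exists 1, z, 0, fz.
pose c := (p + q) / 2.
have pc : p < c by rewrite /c; lra.
have cq : c < q by rewrite /c; lra.
have [Ec|[fc Ec]] := phi_cases c.
  by have := @convex_three_points p c q fp fq _ Ep Eq; rewrite pc cq Ec => /(_ isT).
exists c, fc, (`|(fc - fp) / (c - p)| + `|(fq - fc) / (q - c)|); split.
  exact: addr_ge0.
move=> x; have [xc|cx|->] := ltgtP x c.
- apply: le_trans (convex_left_line cq xc Ec Eq); rewrite lee_fin.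
  rewrite lerD2l lerN2 distrC (@gtr0_norm _ (c - x)) ?subr_gt0// ler_pM2r ?subr_gt0//.
  by apply: le_trans (ler_norm _) _; rewrite lerDr.
- apply: le_trans (convex_right_line pc cx Ep Ec); rewrite lee_fin.
  rewrite lerD2l lerNl -mulNr (@gtr0_norm _ (x - c)) ?subr_gt0// ler_pM2r ?subr_gt0//.
  rewrite -normrN; apply: le_trans (ler_norm _) _; by rewrite lerDl.
- by rewrite subrr normr0 mulr0 subr0 Ec.
Qed.

Lemma pointed_cone_minorant (x0 y : R) : (y%:E < phi x0)%E ->
  exists K : R, 0 <= K /\ forall x, ((y - K * `|x - x0|)%:E <= phi x)%E.
Proof.
move=> yphi; have [_ _ _ lsc _] := Hphi.
have [c [f [A [A0 fA]]]] := convex_cone_minorant.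
have : nbhs x0 (~` [set x | (phi x <= y%:E)%E]).
  apply: open_nbhs_nbhs; split; first by apply: closed_openC; exact: lsc.
  by rewrite /= ; apply/negP; rewrite -ltNge.
move=> /nbhs_ballP[e /= e0 eP].
pose g := f - A * `|x0 - c|.
(* [A] pays for moving the apex from [c] to [x0]; the second term makes the cone drop by [|y - g|]
   at distance [e], where lower semicontinuity stops helping. *)
exists (A + `|y - g| / e); split; first by rewrite addr_ge0// divr_ge0// ltW.
move=> x; have [xe|ex] := ltP `|x - x0| e.
  apply: (@le_trans _ _ y%:E).
    by rewrite lee_fin lerBlDr lerDl mulr_ge0// addr_ge0// divr_ge0// ltW.
  have /= := eP x; rewrite /ball /= distrC => /(_ xe) /negP; rewrite -ltNge.
  exact: ltW.
apply: le_trans (fA x); rewrite lee_fin.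
have h1 : `|x - c| <= `|x - x0| + `|x0 - c|.
  by apply: le_trans (ler_normD _ _); rewrite addrA subrK.
have h2 : A * `|x - c| <= A * `|x - x0| + A * `|x0 - c|.
  by rewrite -mulrDr ler_wpM2l.
have h3 : `|y - g| <= `|y - g| / e * `|x - x0|.
  by rewrite mulrAC ler_pdivlMr// ler_wpM2l.
have h4 := ler_norm (y - g).
rewrite mulrDl; rewrite /g in h3 h4 *; lra.
Qed.

(** The slope is the supremum of those, at most [K], whose line stays below [phi] to the right of
    [x0]. Were that line above [phi] somewhere on the left, a slightly larger slope would still work
    on the right, by [cross]. *)
Lemma affine_minorant (x0 y : R) : (y%:E < phi x0)%E ->
  exists s : R, forall x, ((y + s * (x - x0))%:E <= phi x)%E.
Proof.
move=> yphi; have [K [K0 yK]] := pointed_cone_minorant yphi.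
pose right s := forall x, x0 < x -> ((y + s * (x - x0))%:E <= phi x)%E.
pose E := [set s | s <= K /\ right s].
have EN : E (- K).
  split; first by lra.
  move=> x xx; apply: le_trans (yK x); rewrite lee_fin gtr0_norm ?subr_gt0//; lra.
have Eub : has_ubound E by exists K => s [].
have Esup : has_sup E by split => //; exists (- K).
pose s := sup E.
have sK : s <= K by apply: ge_sup => [|r []//]; exists (- K).
have rs : right s.
  move=> x xx; have [->|[f Ex]] := phi_cases x; first by rewrite leey.
  rewrite Ex lee_fin.
  have : s <= (f - y) / (x - x0).
    apply: ge_sup; first by exists (- K).
    move=> r [_ /(_ x xx)]; rewrite Ex lee_fin ler_pdivlMr ?subr_gt0//; lra.
  rewrite ler_pdivlMr ?subr_gt0//; lra.
(* The line lies strictly above [phi] at [x1]; were it also above at some [x > x0], the chord of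
   [phi] between them would pass below [y] at [x0], against [yphi]. *)
have cross r x1 f1 : x1 < x0 -> phi x1 = f1%:E -> f1 < y + r * (x1 - x0) -> right r.
  move=> x10 E1 f1y x xx; have [->|[f Ex]] := phi_cases x; first by rewrite leey.
  have := @convex_three_points x1 x0 x f1 f _ E1 Ex; rewrite x10 xx => /(_ isT).
  move=> /(lt_le_trans yphi); rewrite Ex lte_fin lee_fin ltr_pdivlMr ?subr_gt0 ?(lt_trans x10)// => h.
  have h2 : 0 < x0 - x1 by rewrite subr_gt0.
  have h3 : 0 < x - x0 by rewrite subr_gt0.
  have h4 : f1 * (x - x0) < (y + r * (x1 - x0)) * (x - x0) by rewrite ltr_pM2r.
  rewrite -(ler_pM2r h2); nra.
exists s => x; have [xl|xg|->] := ltgtP x x0; last 2 first.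
- exact: rs.
- by rewrite subrr mulr0 addr0 ltW.
have [->|[f Ex]] := phi_cases x; first by rewrite leey.
rewrite Ex lee_fin leNgt; apply/negP => fs.
have xx : 0 < x0 - x by rewrite subr_gt0.
pose r := (y - f) / (x0 - x).
have sr : s < r by rewrite /r ltr_pdivlMr//; lra.
have rK : r <= K.
  rewrite /r ler_pdivrMr//; have := yK x; rewrite Ex lee_fin ltr0_norm ?subr_lt0//; lra.
pose r' := (s + r) / 2.
have : r' <= s.
  apply: ub_le_sup => //; split; first by rewrite /r'; lra.
  apply: (cross _ x f) => //.
  have : r' * (x0 - x) < y - f.
    by rewrite -ltr_pdivlMr// -/r /r'; lra.
  lra.
by rewrite /r'; lra.
Qed.

(** Rational slopes and intercepts make the minorants countably many; on [x >= 0], rounding both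
    down keeps a line below [phi]. *)
Lemma entropy_affine_sup : exists s t : nat -> R,
  (forall n x, 0 <= x -> ((s n * x + t n)%:E <= phi x)%E) /\
  (forall x y, 0 <= x -> (y%:E < phi x)%E -> exists n, y < s n * x + t n).
Proof.
pose minor (a : rat * rat) := forall x, 0 <= x -> ((ratr a.1 * x + ratr a.2 : R)%:E <= phi x)%E.
have dense x y : 0 <= x -> (y%:E < phi x)%E ->
    exists a, minor a /\ y < ratr a.1 * x + ratr a.2.
  move=> x0 yphi.
  have [z yz zphi] : exists2 z, y < z & (z%:E < phi x)%E.
    have [->|[f Ex]] := phi_cases x; first by exists (y + 1); rewrite ?ltry// ltrDl.
    by exists ((y + f) / 2); move: yphi; rewrite Ex !lte_fin; lra.
  have [s sP] := affine_minorant zphi.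
  (* Rounding slope and intercept down by less than [e] costs less than [e * (x + 1)] at [x], hence
     less than [z - y]. *)
  pose e := (z - y) / (x + 2).
  have e0 : 0 < e by rewrite divr_gt0//; lra.
  have ex : e * (x + 2) = z - y by rewrite /e divfK// gt_eqF//; lra.
  have [a] : exists q : rat, (ratr q : R) \in `]s - e, s[ by apply: rat_in_itvoo; lra.
  rewrite in_itv /= => /andP[a1 a2].
  have [b] : exists q : rat, (ratr q : R) \in `]z - s * x - e, z - s * x[ by apply: rat_in_itvoo; lra.
  rewrite in_itv /= => /andP[b1 b2].
  exists (a, b); split => /=.
    move=> u u0; apply: le_trans (sP u); rewrite lee_fin /=.
    have : ratr a * u <= s * u by rewrite ler_wpM2r// ltW.
    lra.
  have : (s - e) * x <= ratr a * x by rewrite ler_wpM2r// ltW.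
  lra.
(* A default minorant, for the codes that denote none. *)
have [a0 [ma0 _]] : exists a, minor a /\ (-1 : R) < ratr a.1 * 1 + ratr a.2.
  by apply: dense => //; have [_ _ _ _ ->] := Hphi; rewrite lte_fin.
pose a n := let b := odflt a0 (unpickle n) in if `[< minor b >] then b else a0.
exists (fun n => ratr (a n).1), (fun n => ratr (a n).2); split.
  by move=> n x x0; rewrite /a; case: asboolP => [|_]; [exact|exact: ma0].
move=> x y x0 /(dense _ _ x0)[b [mb yb]]; exists (pickle b).
by rewrite /a pickleK /= asboolT.
Qed.

(** Dividing the minorants by [x] gives the lower bound. For the upper one, [phi 1 = 0] makes each
    minorant at most [s n * (x - 1)] for [x >= 1], so [phi x] is at most [r * (x - 1)] when the
    supremum is a real [r]. *)
Lemma recessionE (s t : nat -> R) :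
  (forall n x, 0 <= x -> ((s n * x + t n)%:E <= phi x)%E) ->
  (forall x y, 0 <= x -> (y%:E < phi x)%E -> exists n, y < s n * x + t n) ->
  recession phi = ereal_sup (range (EFin \o s)).
Proof.
move=> lower dense; set S := ereal_sup _; have [_ _ _ _ phi1] := Hphi.
have sS n : ((s n)%:E <= S)%E by apply: ereal_sup_ubound; exists n.
have lowdiv n x : 1 <= x -> ((s n + t n / x)%:E <= phi x * (x^-1)%:E)%E.
  move=> x1; have x0 : 0 < x by exact: lt_le_trans x1.
  rewrite (_ : s n + t n / x = (s n * x + t n) * x^-1); last first.
    by rewrite mulrDl mulfK// gt_eqF.
  rewrite EFinM; apply: lee_wpmul2r; first by rewrite lee_fin invr_ge0 ltW.
  exact: lower (ltW x0).
have near_low n (e : R) : 0 < e ->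
    \forall x \near +oo%R, ((s n - e)%:E <= phi x * (x^-1)%:E)%E.
  move=> e0; have := nbhs_pinfty_ge (num_real (Num.max 1 (`|t n| / e))).
  apply: filterS => x; rewrite ge_max => /andP[x1 xt].
  have x0 : 0 < x by exact: lt_le_trans x1.
  apply: le_trans (lowdiv n x x1); rewrite lee_fin lerD2l lerNl -mulNr.
  apply: (@le_trans _ _ (`|t n| / x)).
    by rewrite ler_pM2r ?invr_gt0// -normrN ler_norm.
  by rewrite ler_pdivrMr// mulrC -ler_pdivrMr.
apply: cvg_lim => //.
case ES : S => [r| |].
- have up x : 1 <= x -> (phi x * (x^-1)%:E <= (r + `|r| / x)%:E)%E.
    move=> x1; have x0 : 0 < x by exact: lt_le_trans x1.
    have phir : (phi x <= (r * (x - 1))%:E)%E.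
      rewrite leNgt; apply/negP => /(dense _ _ (ltW x0))[n].
      have := lower n 1 ler01; rewrite phi1 lee_fin mulr1 => st1.
      have : s n * (x - 1) <= r * (x - 1).
        by rewrite ler_wpM2r ?subr_ge0//; move: (sS n); rewrite ES lee_fin.
      lra.
    apply: (@le_trans _ _ ((r * (x - 1))%:E * (x^-1)%:E)%E).
      by apply: lee_wpmul2r => //; rewrite lee_fin invr_ge0 ltW.
    rewrite -EFinM lee_fin mulrBr mulr1 mulrBl mulfK ?gt_eqF// lerD2l -mulNr.
    by rewrite ler_pM2r ?invr_gt0// -normrN ler_norm.
  have bounds (e : R) : 0 < e -> \forall x \near +oo%R, exists v,
      (phi x * (x^-1)%:E)%E = v%:E /\ `|r - v| <= e.
    move=> e0.
    have [_ [n _ <-] /=] : exists2 y, range (EFin \o s) y & ((r - e / 2)%:E < y)%E.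
      by apply: ereal_sup_gt; rewrite -/S ES lte_fin; lra.
    rewrite lte_fin => rn.
    have e2 : 0 < e / 2 by lra.
    have := nbhs_pinfty_ge (num_real (Num.max 1 (`|r| / e))).
    have := near_low n (e / 2) e2; apply: filterS2 => x low.
    rewrite ge_max => /andP[x1 xr]; have {}up := up x x1.
    have x0 : 0 < x by exact: lt_le_trans x1.
    have re : `|r| / x <= e by rewrite ler_pdivrMr// mulrC -ler_pdivrMr.
    case: (phi x * _)%E low up => [v| |]//; rewrite !lee_fin => low up.
    by exists v; split => //; rewrite ler_norml; apply/andP; split; lra.
  apply/fine_cvgP; split.
    by have := bounds 1 ltr01; apply: filterS => x [v [-> _]].
  apply/cvgrPdist_le => e /bounds; apply: filterS => x [v [/= -> ?]] //.
- apply/cvgeyPge => A.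
  have [_ [n _ <-] /= An] : exists2 y, range (EFin \o s) y & ((A + 1)%:E < y)%E.
    by apply: ereal_sup_gt; rewrite -/S ES ltry.
  have := near_low n 1 ltr01; apply: filterS => x; apply: le_trans.
  by rewrite lee_fin; move: An; rewrite lte_fin; lra.
- by move: (sS 0%N); rewrite ES leeNy_eq.
Qed.

End entropy_minorants.

(** * Data processing for divergences *)

Section integral_order.
Context d (T : measurableType d) (R : realType) (mu : {measure set T -> \bar R}).
Local Open Scope ereal_scope.

(* No measurability is needed: the integral of a nonnegative function is defined
   as a supremum over the simple functions below it. *)
Lemma le_integral_pointwise (D : set T) (f g : T -> \bar R) :
  (forall x, D x -> f x <= g x) -> \int[mu]_(x in D) f x <= \int[mu]_(x in D) g x.
Proof.
move=> fg; rewrite !(integral_mkcond D).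
have {}fg x : (f \_ D) x <= (g \_ D) x.
  by rewrite /patch; case: ifPn => //; rewrite in_setE; exact: fg.
rewrite (integralE _ setT (f \_ D)) (integralE _ setT (g \_ D)).
have sup_le (u v : T -> \bar R) : (forall x, 0 <= u x) -> (forall x, 0 <= v x) ->
    (forall x, u x <= v x) -> \int[mu]_x u x <= \int[mu]_x v x.
  move=> u0 v0 uv; rewrite !ge0_integralTE//; apply: le_ereal_sup => _ [h hu <-].
  by exists h => // x; exact: le_trans (uv x).
apply: leeB; apply: sup_le => // x.
  by rewrite !funeposE ge_max !le_max fg lexx orbT.
by rewrite !funenegE ge_max !le_max leeN2 fg lexx orbT.
Qed.

(** If [f] has infinite integral, the negative part of the sum is still dominated by [|g|] while its
    positive part has infinite integral, so both sides are [+oo]. *)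
Lemma integral_ge0D_integrable (D : set T) (f : T -> \bar R) (g : T -> R) :
  measurable D -> measurable_fun D f -> (forall x, D x -> 0 <= f x) ->
  mu.-integrable D (EFin \o g) ->
  \int[mu]_(x in D) (f x + (g x)%:E) =
  \int[mu]_(x in D) f x + \int[mu]_(x in D) (g x)%:E.
Proof.
move=> mD mf f0 ig.
have [foo|foo] := ltP (\int[mu]_(x in D) f x) +oo.
  apply: integralD => //; apply/integrableP; split => //.
  rewrite (eq_integral f)// => x; rewrite inE => Dx; rewrite gee0_abs//; exact: f0.
have {}foo : \int[mu]_(x in D) f x = +oo by apply/eqP; rewrite -leye_eq.
have /integrableP[mg goo] := ig.
have gfin : \int[mu]_(x in D) (g x)%:E \is a fin_num by exact: integrable_fin_num ig.
set k := fun x => f x + (g x)%:E.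
have mk : measurable_fun D k by exact: emeasurable_funD.
have kneg : \int[mu]_(x in D) k^\- x < +oo.
  apply: le_lt_trans goo; apply: le_integral_pointwise => x Dx.
  rewrite funenegE ge_max abse_ge0 andbT /k; move: (f0 x Dx).
  case: (f x) => [u| |]//=; rewrite ?leNye// !lee_fin => u0.
  by rewrite -normrN; have := ler_norm (- g x); lra.
have kpos : \int[mu]_(x in D) k^\+ x = +oo.
  apply/eqP; rewrite -leye_eq leNgt; apply/negP => kfin.
  have : \int[mu]_(x in D) f x < +oo.
    apply: (@le_lt_trans _ _ (\int[mu]_(x in D) (k^\+ x + `|(g x)%:E|))); last first.
      rewrite ge0_integralD//; first exact: lte_add_pinfty.
      - exact: measurable_funepos.
      - exact: measurableT_comp.
    apply: le_integral_pointwise => x Dx.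
    apply: (@le_trans _ _ (k x + `|(g x)%:E|)); last first.
      by rewrite leeD2r// funeposE le_max lexx.
    rewrite /k; move: (f0 x Dx); case: (f x) => [u| |]//= u0.
    by rewrite !lee_fin; have := ler_norm (- g x); rewrite normrN; lra.
  by rewrite foo ltxx.
have kfin : \int[mu]_(x in D) k^\- x \is a fin_num.
  by rewrite ge0_fin_numE//; apply: integral_ge0.
rewrite [LHS]integralE kpos foo !addye//.
  by rewrite -ltNye; move: gfin; rewrite fin_numElt => /andP[].
by move: kfin; rewrite -fin_numN fin_numE => /andP[].
Qed.

End integral_order.

(** [N] is a [nu]-null set of maximal [mu]-mass. A [nu]-null set outside it is [mu]-null, since
    adding it to [N] cannot increase the mass; so [mu] off [N] has a Radon-Nikodym density. *)
Lemma lebesgue_decomp_ex d (T : measurableType d) (R : realType)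
    (mu nu : {finite_measure set T -> \bar R}) :
  exists h N, lebesgue_decomp mu nu h N.
Proof.
pose S := [set mu A | A in [set A | measurable A /\ nu A = 0%E]].
have S0 : S (mu set0) by exists set0; split => //; exact: measure0.
have Sfin : ereal_sup S \is a fin_num.
  rewrite ge0_fin_numE; last by apply: ereal_sup_ubound; rewrite -(measure0 mu).
  apply: (@le_lt_trans _ _ (mu setT)); last by rewrite ltey_eq fin_num_measure.
  by apply: ge_ereal_sup => _ [A [mA _] <-]; apply: le_measure; rewrite ?inE.
have /choice[A AP] : forall n, exists A, [/\ measurable A, nu A = 0%E &
    (ereal_sup S - n.+1%:R^-1%:E < mu A)%E].
  move=> n; have n0 : 0 < n.+1%:R^-1 :> R by rewrite invr_gt0.
  by have [_ [A [mA A0] <-] Al] := ub_ereal_sup_adherent n0 Sfin; exists A.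
have mA n : measurable (A n) by have [] := AP n.
pose N := \bigcup_n A n.
have mN : measurable N by exact: bigcup_measurable.
have nuN : nu N = 0%E.
  apply: measure_negligible => //; apply: negligible_bigcup => n.
  by exists (A n); split => //; have [] := AP n.
have muN : mu N = ereal_sup S.
  apply/eqP; rewrite eq_le; apply/andP; split.
    by apply: ereal_sup_ubound; exists N.
  apply/lee_addgt0Pr => e e0.
  have [n ne] := inv_natS_le e0.
  have [_ _ /ltW Al] := AP n.
  rewrite -leeBlDr//; apply: le_trans (_ : _ <= mu (A n))%E _.
    by apply: le_trans Al; rewrite leeB// lee_fin.
  by apply: le_measure; rewrite ?inE//; exact: bigcup_sup.
have mCN : measurable (~` N) by exact: measurableC.
have muCN : (mu (~` N) < +oo)%E by rewrite ltey_eq fin_num_measure.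
pose mu1 : {finite_measure set T -> \bar R} := mfrestr mCN muCN.
have mu1E B : mu1 B = mu (B `&` ~` N) by [].
have dom : mu1 `<< nu.
  apply/null_content_dominatesP => B mB nuB; rewrite mu1E.
  have mBN : measurable (B `&` ~` N) by exact: measurableI.
  have nuBN : nu (B `&` ~` N) = 0%E.
    by apply: (@subset_measure0 _ _ _ nu _ B) => //; exact: subIsetl.
  have : (mu (N `|` (B `&` ~` N)) <= mu N)%E.
    rewrite [leRHS]muN; apply: ereal_sup_ubound.
    exists (N `|` (B `&` ~` N)) => //; split; first exact: measurableU.
    exact: (etrans (measureU0 mN mBN nuBN) nuN).
  rewrite measureU//; last by rewrite setIA setIAC setICr set0I.
  rewrite -leeBrDl ?fin_num_measure// subee ?fin_num_measure// => h.
  by apply/eqP; rewrite eq_le h measure_ge0.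
have [f [f0 ffin fint fE]] := radon_nikodym_sigma_finite dom.
exists (fine \o f), N; split => //.
- apply: measurableT_comp => //; exact: measurable_int fint.
- by move=> x; exact: fine_ge0.
move=> B mB; rewrite (_ : \int[nu]_(x in B) _ = mu1 B)%E; last first.
  by rewrite fE//; apply: eq_integral => x _ /=; rewrite fineK.
rewrite mu1E -measureU//; first by rewrite -setIUr setUC setUv setIT.
- exact: measurableI.
- exact: measurableI.
- by rewrite setIACA setICl setI0.
Qed.

Section affine_envelope.
Context (R : realType) (phi : R -> \bar R) (s t : nat -> R).
Hypothesis Hphi : entropy_function phi.
Hypothesis lower : forall n x, 0 <= x -> ((s n * x + t n)%:E <= phi x)%E.
Hypothesis dense : forall x y, 0 <= x -> (y%:E < phi x)%E ->
  exists n, y < s n * x + t n.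

(* Subtracting the affine function of index 0 makes everything below nonnegative. *)
Definition excess n x : R := (s n - s 0%N) * x + (t n - t 0%N).

(** The start 0 is the excess of index 0; the maxima increase with [n], so monotone convergence
    applies to their limit [gap]. *)
Fixpoint envelope n x : R :=
  if n is n'.+1 then Num.max (envelope n' x) (excess n x) else 0.

Definition gap (x : R) : \bar R := limn (fun n => (envelope n x)%:E).

Definition gap_slope : \bar R := ereal_sup (range (fun n => (s n - s 0%N)%:E)).

Lemma envelope_ge0 n x : 0 <= envelope n x.
Proof. by elim: n => //= n IH; rewrite le_max IH. Qed.

Lemma envelope_nd x : {homo (fun n => (envelope n x)%:E) : n m / (n <= m)%N >-> (n <= m)%E}.
Proof.
by apply/nondecreasing_seqP => n; rewrite lee_fin /= le_max lexx.
Qed.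

Lemma envelope_gap n x : ((envelope n x)%:E <= gap x)%E.
Proof.
rewrite /gap (cvg_lim _ (ereal_nondecreasing_cvgn (@envelope_nd x)))//.
by apply: ereal_sup_ubound; exists n.
Qed.

Lemma gap_ge0 x : (0 <= gap x)%E. Proof. exact: (envelope_gap 0 x). Qed.

Lemma excess_envelope n x : excess n x <= envelope n x.
Proof.
by case: n => [|n]; [rewrite /excess !subrr mul0r addr0|rewrite /= le_max lexx orbT].
Qed.

Lemma excess_gap n x : ((excess n x)%:E <= gap x)%E.
Proof. by apply: le_trans (envelope_gap n x); rewrite lee_fin excess_envelope. Qed.

Lemma gap_slope_ge n : ((s n - s 0%N)%:E <= gap_slope)%E.
Proof. by apply: ereal_sup_ubound; exists n. Qed.

Lemma gap_slope_ge0 : (0 <= gap_slope)%E.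
Proof. by have := gap_slope_ge 0; rewrite subrr. Qed.

Lemma entropy_gapE x : 0 <= x -> phi x = (gap x + (s 0%N * x + t 0%N)%:E)%E.
Proof.
move=> x0; apply/eqP; rewrite eq_le; apply/andP; split.
  rewrite leNgt; apply/negP.
  have := gap_ge0 x; case E : (gap x) => [g| |]// _.
    rewrite -EFinD => /(dense x0)[n].
    have := excess_gap n x; rewrite E lee_fin /excess; lra.
  by rewrite addye// ltNge leey.
rewrite -leeBrDr// /gap (cvg_lim _ (ereal_nondecreasing_cvgn (@envelope_nd x)))//.
apply: ge_ereal_sup => _ [n _ <-]; rewrite leeBrDr//.
elim: n => [|n IH]; first by rewrite /= add0e; exact: lower.
rewrite -EFinD /= addr_maxl EFin_max ge_max EFinD IH /=.
by apply: le_trans (lower n.+1 x0); rewrite lee_fin /excess; lra.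
Qed.

Lemma recession_gapE : recession phi = (gap_slope + (s 0%N)%:E)%E.
Proof.
rewrite (recessionE Hphi lower dense); apply/eqP; rewrite eq_le; apply/andP; split.
  apply: ge_ereal_sup => _ [n _ <-] /=; rewrite -leeBlDr//.
  by rewrite -EFinB; exact: gap_slope_ge.
rewrite -leeBrDr//; apply: ge_ereal_sup => _ [n _ <-]; rewrite leeBrDr// -EFinD subrK.
by apply: ereal_sup_ubound; exists n.
Qed.

Section decomposition.
Context d (T : measurableType d) (mu nu : {finite_measure set T -> \bar R}).
Variables (h : T -> R) (N : set T).
Hypothesis dec : lebesgue_decomp mu nu h N.
Local Open Scope ereal_scope.

Let mN : measurable N. Proof. by case: dec. Qed.
Let mh : measurable_fun setT h. Proof. by case: dec. Qed.
Let h0 x : (0 <= h x)%R. Proof. by case: dec. Qed.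
Let muE A : measurable A -> mu A = \int[nu]_(x in A) (h x)%:E + mu (A `&` N).
Proof. by move=> mA; case: dec => _ _ _ _; exact. Qed.

(** The part of the divergence carried by [B] once the affine minorant of index 0 is subtracted; it
    is nonnegative and additive in [B]. *)
Definition gap_cost (B : set T) : \bar R :=
  \int[nu]_(x in B) gap (h x) + gap_slope * mu (B `&` N).

Lemma integrable_density B : measurable B -> nu.-integrable B (EFin \o h).
Proof.
move=> mB; apply/integrableP; split.
  by apply/measurable_EFinP; exact: measurable_funTS.
rewrite (eq_integral (EFin \o h)); last by move=> x _ /=; rewrite ger0_norm.
apply: (@le_lt_trans _ _ (mu B)); last by rewrite ltey_eq fin_num_measure.
by rewrite [leRHS]muE// leeDl.
Qed.

Lemma integrable_affine_density B (a b : R) : measurable B ->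
  nu.-integrable B (fun x => (a * h x + b)%:E).
Proof.
move=> mB; rewrite (_ : (fun x => _) = (fun x => a%:E * (EFin \o h) x) \+ cst b%:E)//.
apply: integrableD => //; last exact: finite_measure_integrable_cst.
by apply: integrableZl => //; exact: integrable_density.
Qed.

Lemma integral_affine_density B (a b : R) : measurable B ->
  \int[nu]_(x in B) (a * h x + b)%:E = a%:E * \int[nu]_(x in B) (h x)%:E + b%:E * nu B.
Proof.
move=> mB; have ih := integrable_density mB.
under eq_integral do rewrite EFinD EFinM.
rewrite integralD//; last 2 first.
- exact: integrableZl.
- exact: finite_measure_integrable_cst.
by rewrite integralZl// integral_cst.
Qed.

Lemma measurable_excess n B : measurable B -> measurable_fun B (fun x => excess n (h x)).
Proof.
move=> mB; apply: measurable_funTS; rewrite /excess.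
by apply: measurable_funD => //; apply: measurable_funM.
Qed.

Lemma measurable_envelope n B : measurable B -> measurable_fun B (fun x => envelope n (h x)).
Proof.
move=> mB; elim: n => [|n IH] //=; apply: measurable_maxr => //.
exact: measurable_excess.
Qed.

Lemma measurable_gap B : measurable B -> measurable_fun B (gap \o h).
Proof.
move=> mB; apply: (emeasurable_fun_cvg (fun n x => (envelope n (h x))%:E)) => [n|x Bx].
  by apply/measurable_EFinP; exact: measurable_envelope.
rewrite /= /gap; apply: ereal_nondecreasing_is_cvgn; exact: envelope_nd.
Qed.

(** The subtracted affine function contributes only through the total masses, which a pushforward
    preserves; data processing thus reduces to comparing [gap_cost]. *)
Lemma divergence_value : \int[nu]_x phi (h x) + recession phi * mu N =
  gap_cost setT + ((s 0%N)%:E * mu setT + (t 0%N)%:E * nu setT).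
Proof.
have muNfin : mu N \is a fin_num by exact: fin_num_measure.
under eq_integral do rewrite entropy_gapE//.
rewrite integral_ge0D_integrable//; last 3 first.
- exact: (measurable_gap measurableT).
- by move=> x _; exact: gap_ge0.
- exact: integrable_affine_density.
rewrite integral_affine_density// recession_gapE muleDl//; last first.
  by rewrite fin_num_adde_defl.
rewrite (muE measurableT) /gap_cost !setTI (@muleDr _ (s 0%N)%:E (\int[nu]_x (h x)%:E) (mu N))//; last first.
  by rewrite fin_num_adde_defl.
by rewrite addeACA; congr (_ + _); rewrite addeAC.
Qed.

Lemma gap_cost_ge n B : measurable B ->
  (s n - s 0%N)%:E * mu B + (t n - t 0%N)%:E * nu B <= gap_cost B.
Proof.
move=> mB; have muBN : mu (B `&` N) \is a fin_num.
  by apply: fin_num_measure; exact: measurableI.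
rewrite [X in _ * X + _]muE//.
rewrite (@muleDr _ _ (\int[nu]_(x in B) (h x)%:E) (mu (B `&` N)))//; last by rewrite fin_num_adde_defl.
rewrite addeAC -integral_affine_density//; apply: leeD.
  by apply: le_integral_pointwise => x _; exact: excess_gap.
by apply: lee_wpmul2r => //; exact: gap_slope_ge.
Qed.

Lemma gap_cost_ge0 B : 0 <= gap_cost B.
Proof.
apply: adde_ge0; first by apply: integral_ge0 => x _; exact: gap_ge0.
by apply: mule_ge0 => //; exact: gap_slope_ge0.
Qed.

Lemma gap_costU A B : measurable A -> measurable B -> A `&` B = set0 ->
  gap_cost (A `|` B) = gap_cost A + gap_cost B.
Proof.
move=> mA mB AB; rewrite /gap_cost ge0_integral_setU//; last 3 first.
- by apply: measurable_gap; exact: measurableU.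
- by move=> x _; exact: gap_ge0.
- by apply/eqP.
rewrite setIUl measureU//; last 3 first.
- exact: measurableI.
- exact: measurableI.
- by rewrite setIACA AB set0I.
by rewrite ge0_muleDr// addeACA.
Qed.

End decomposition.

End affine_envelope.

Section data_processing.
Context d1 d2 (T1 : measurableType d1) (T2 : measurableType d2) (R : realType).
Variables (mu nu : {finite_measure set T1 -> \bar R}) (f : T1 -> T2).
Hypothesis mf : measurable_fun setT f.
Variables s t : nat -> R.
Local Open Scope ereal_scope.

Let mu' := finite_pushforward mu mf.
Let nu' := finite_pushforward nu mf.

Variables (h : T1 -> R) (N : set T1) (h' : T2 -> R) (N' : set T2).
Hypothesis dec : lebesgue_decomp mu nu h N.
Hypothesis dec' : lebesgue_decomp mu' nu' h' N'.

Let C := gap_cost s t mu nu h N.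

Let mpre A : measurable A -> measurable (f @^-1` A).
Proof. by move=> mA; rewrite -[X in measurable X]setTI; exact: mf. Qed.

Let mN' : measurable N'. Proof. by case: dec'. Qed.

Let C_ge n B : measurable B ->
  (s n - s 0%N)%:E * mu' B + (t n - t 0%N)%:E * nu' B <= C (f @^-1` B).
Proof. by move=> mB; exact: (gap_cost_ge s t dec n (mpre mB)). Qed.

(** The cell where [excess n.+1] is the strict maximum is split off: there the integrand is affine
    in [h'], so its integral is a combination of masses, bounded through [C_ge] on the preimage. The
    rest falls under the induction hypothesis. *)
Lemma envelope_cost n B : measurable B -> B `&` N' = set0 ->
  \int[nu']_(x in B) (envelope s t n (h' x))%:E <= C (f @^-1` B).
Proof.
elim: n B => [|n IH] B mB BN.
  by rewrite integral0; exact: gap_cost_ge0.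
have menv k D : measurable D -> measurable_fun D (fun x => (envelope s t k (h' x))%:E).
  by move=> mD; apply/measurable_EFinP; exact: (measurable_envelope s t dec').
have env0 k x : 0 <= (envelope s t k (h' x))%:E by rewrite lee_fin envelope_ge0.
pose G := [set x | (envelope s t n (h' x))%:E < (excess s t n.+1 (h' x))%:E].
have mG : measurable G.
  rewrite -[X in measurable X]setTI; apply: measurable_lte => //.
    exact: menv.
  by apply/measurable_EFinP; exact: (measurable_excess s t dec').
have mBG : measurable (B `&` G) by exact: measurableI.
have mBD : measurable (B `\` G) by exact: measurableD.
have sub0 D : D `<=` B -> D `&` N' = set0.
  move=> DB; apply/seteqP; split => x //= [Dx Nx]; have : (B `&` N') x by split => //; exact: DB.
  by rewrite BN.
have BGN : B `&` G `&` N' = set0 by apply: sub0 => x [].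
rewrite -{1}(setUIDK B G).
rewrite ge0_integral_setU//; last 2 first.
- by apply: menv; exact: measurableU.
- by apply/eqP/seteqP; split => x //= [[_ ?] [_ ?]].
have -> : C (f @^-1` B) = C (f @^-1` (B `&` G)) + C (f @^-1` (B `\` G)).
  rewrite -[in LHS](setUIDK B G) preimage_setU.
  apply: (gap_costU s t dec); [exact: mpre|exact: mpre|].
  by rewrite -preimage_setI; apply/seteqP; split => x //= [[_ ?] [_ ?]].
apply: leeD.
  apply: le_trans (C_ge n.+1 mBG).
  rewrite [X in _ <= _ * X + _](_ : _ = \int[nu']_(x in B `&` G) (h' x)%:E); last first.
    have [_ _ _ _ ->//] := dec'.
    by rewrite BGN measure0 adde0.
  rewrite -(integral_affine_density dec')//; apply: le_integral_pointwise => x [_ Gx].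
  by rewrite lee_fin /= ge_max lexx andbT -lee_fin; exact: ltW.
apply: le_trans (IH _ mBD _); last by apply: sub0 => x [].
apply: le_integral_pointwise => x [_ nGx].
by rewrite lee_fin /= ge_max lexx /= -lee_fin leNgt; apply/negP.
Qed.

(** Off [N'] the envelopes increase to the gap, and [envelope_cost] passes to the limit. On [N'],
    which is [nu']-null, [C_ge] bounds each slope times [mu' N'], hence also their supremum. *)
Lemma gap_cost_pushforward : gap_cost s t mu' nu' h' N' setT <= C setT.
Proof.
have mCN' : measurable (~` N') by exact: measurableC.
have CU : C setT = C (f @^-1` (~` N')) + C (f @^-1` N').
  rewrite -[in LHS](preimage_setT f) -(setvU N') preimage_setU.
  apply: (gap_costU s t dec); [exact: mpre|exact: mpre|].
  by rewrite -preimage_setI setICl preimage_set0.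
rewrite CU -(setvU N') (gap_costU s t dec')//; last by rewrite setICl.
have nuN' : nu' N' = 0 by case: dec'.
apply: leeD; rewrite /gap_cost.
  rewrite setICl measure0 mule0 adde0.
  have cvi := @cvg_monotone_convergence _ _ _ nu' _ mCN' (fun n x => (envelope s t n (h' x))%:E) _ _ _.
  rewrite /gap -(cvg_lim _ (cvi _ _ _))//; last 3 first.
  - by move=> n; apply/measurable_EFinP; exact: (measurable_envelope s t dec').
  - by move=> n x _; rewrite lee_fin envelope_ge0.
  - by move=> x _; exact: envelope_nd.
  apply: lime_le.
    apply/cvg_ex; eexists; apply: cvi.
    - by move=> n; apply/measurable_EFinP; exact: (measurable_envelope s t dec').
    - by move=> n x _; rewrite lee_fin envelope_ge0.
    - by move=> x _; exact: envelope_nd.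
  by apply: nearW => n; apply: envelope_cost => //; rewrite setICl.
rewrite setIid null_set_integral//; last exact: (measurable_gap s t dec').
rewrite add0e.
have muN'fin : mu' N' \is a fin_num by exact: fin_num_measure.
have [->|muN'0] := eqVneq (mu' N') 0; first by rewrite mule0; exact: gap_cost_ge0.
have m0 : (0 < fine (mu' N'))%R.
  by rewrite fine_gt0// lt_neqAle eq_sym muN'0 measure_ge0/= ltey_eq muN'fin.
rewrite -(fineK muN'fin) -lee_pdivlMr//; apply: ge_ereal_sup => _ [n _ <-].
rewrite lee_pdivlMr// fineK//; have := C_ge n mN'.
by rewrite nuN' mule0 adde0.
Qed.

End data_processing.

Lemma divergence_pushforward_le d1 d2 (T1 : measurableType d1)
    (T2 : measurableType d2) (R : realType)
    (mu nu : {finite_measure set T1 -> \bar R}) (f : T1 -> T2) (phi : R -> \bar R) :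
  measurable_fun setT f -> entropy_function phi ->
  (divergence phi (pushforward mu f) (pushforward nu f) <= divergence phi mu nu)%E.
Proof.
move=> mf Hphi; have [s [t [lower dense]]] := entropy_affine_sup Hphi.
have [h' [N' dec']] := lebesgue_decomp_ex (finite_pushforward mu mf) (finite_pushforward nu mf).
apply: le_ereal_inf_tmp => _ [h [N [dec ->]]].
apply: (@le_trans _ _ (\int[finite_pushforward nu mf]_x phi (h' x) +
    recession phi * finite_pushforward mu mf N')%E).
  by apply: ereal_inf_lbound; exists h', N'.
rewrite (divergence_value Hphi lower dense dec') (divergence_value Hphi lower dense dec).
by apply: leeD => //; exact: gap_cost_pushforward.
Qed.

(** As [gap_cost] is nonnegative, the affine term, finite for finite measures, is a lower bound. *)
Lemma divergence_gtNy d (T : measurableType d) (R : realType)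
    (mu nu : {finite_measure set T -> \bar R}) (phi : R -> \bar R) :
  entropy_function phi -> (-oo < divergence phi mu nu)%E.
Proof.
move=> Hphi; have [s [t [lower dense]]] := entropy_affine_sup Hphi.
have c_fin : ((s 0%N)%:E * mu setT + (t 0%N)%:E * nu setT)%E \is a fin_num.
  by rewrite fin_numD !fin_numM// fin_num_measure.
apply: (@lt_le_trans _ _ ((s 0%N)%:E * mu setT + (t 0%N)%:E * nu setT)%E).
  by move: c_fin; rewrite fin_numElt => /andP[].
apply: le_ereal_inf_tmp => _ [h [N [dec ->]]].
rewrite (divergence_value Hphi lower dense dec) leeDr//.
exact: gap_cost_ge0.
Qed.

(** * Sliced transport *)

Lemma divergence_eqmeasure d (T : measurableType d) (R : realType)
    (phi : R -> \bar R) (mu1 mu2 nu : set T -> \bar R) :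
  (forall A, measurable A -> mu1 A = mu2 A) ->
  divergence phi mu1 nu = divergence phi mu2 nu.
Proof.
wlog suff H : mu1 mu2 / (forall A, measurable A -> mu1 A = mu2 A) ->
    (divergence phi mu1 nu <= divergence phi mu2 nu)%E.
  by move=> h; apply/eqP; rewrite eq_le !H// => A mA; rewrite h.
move=> mu12; apply: le_ereal_inf_tmp => _ [h [N [[mN nuN mh h0 dec] ->]]].
apply: ereal_inf_lbound; exists h, N; rewrite mu12//; split => //; split => // A mA.
by rewrite !mu12//; [exact: dec|exact: measurableI].
Qed.

(** Every coupling of [mu1] and [mu2] competes in the unbalanced problem, where its penalties are
    the two divergences bounded by [c]. *)
Lemma UOT_le (R : realType) (C1 : R * R -> \bar R) (phi1 phi2 : R -> \bar R)
    (mu1 mu2 nu1 nu2 : set R -> \bar R) (c : R) :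
  (divergence phi1 mu1 nu1 + divergence phi2 mu2 nu2 <= c%:E)%E ->
  (UOT C1 phi1 phi2 nu1 nu2 <= OT C1 mu1 mu2 + c%:E)%E.
Proof.
move=> dc; rewrite -leeBlDr//; apply: le_ereal_inf_tmp => _ [pi [pi1 pi2 ->]].
rewrite leeBlDr//.
apply: (@le_trans _ _ (\int[pi]_z C1 z + divergence phi1 (pushforward pi fst) nu1 +
    divergence phi2 (pushforward pi snd) nu2)%E).
  by apply: ereal_inf_lbound; exists pi.
by rewrite (divergence_eqmeasure _ _ pi1) (divergence_eqmeasure _ _ pi2) -addeA leeD2l.
Qed.

Section projections.
Context (R : realType) (d : nat).

Lemma measurable_proj2 :
  measurable_fun setT (fun z : d.-tuple R * d.-tuple R => Defs.proj z.1 z.2).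
Proof.
apply: measurable_sum => i; apply: measurable_funM.
- exact: (measurableT_comp (measurable_tnth i) measurable_fst).
- exact: (measurableT_comp (measurable_tnth i) measurable_snd).
Qed.

Lemma measurable_proj (theta : d.-tuple R) : measurable_fun setT (Defs.proj theta).
Proof.
apply: measurable_sum => i; apply: measurable_funM => //; exact: measurable_tnth.
Qed.

Lemma measurable_sphere : measurable (@Defs.sphere R d).
Proof.
rewrite (_ : @Defs.sphere R d = (fun x => Defs.proj x x) @^-1` [set 1%R]).
  rewrite -[X in measurable X]setTI.
  suff : measurable_fun setT (fun x : d.-tuple R => Defs.proj x x) by apply.
  apply: measurable_sum => i; apply: measurable_funM => //; exact: measurable_tnth.
apply/seteqP; split => x; rewrite /Defs.sphere /enorm /=.
  move=> x1; have [x0|x0] := leP 0 (Defs.proj x x).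
    by rewrite -(sqr_sqrtr x0) x1 expr1n.
  by move: x1; rewrite ltr0_sqrtr// => /eqP; rewrite eq_sym oner_eq0.
by move=> ->; rewrite sqrtr1.
Qed.

Lemma measurable_proj_law (p : {finite_measure set (d.-tuple R) -> \bar R}) A :
  measurable A ->
  measurable_fun setT (fun theta => finite_pushforward p (measurable_proj theta) A).
Proof.
move=> mA; pose E := [set z : d.-tuple R * d.-tuple R | A (Defs.proj z.1 z.2)].
have mE : measurable E.
  by rewrite -[X in measurable X]setTI; exact: measurable_proj2.
rewrite (_ : (fun theta => _) = p \o xsection E).
  exact: measurable_fun_xsection mE.
apply/funext => theta; rewrite [LHS]/(p (Defs.proj theta @^-1` A)) /= /xsection.
by congr (p _); apply/seteqP; split => x /=; rewrite in_setE.
Qed.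

End projections.

Theorem theorem6 (R : realType) (d : nat)
    (sigma : {measure set (d.-tuple R) -> \bar R})
    (C1 : R * R -> \bar R) (phi1 phi2 : R -> \bar R)
    (X : set (d.-tuple R)) (Rad : R)
    (a b : {finite_measure set (d.-tuple R) -> \bar R}) :
  uniform_on_sphere sigma ->
  measurable_fun setT C1 ->
  (forall z, (0 <= C1 z)%E) ->
  entropy_function phi1 -> entropy_function phi2 ->
  compact (tuple_to_row @` X) ->
  (forall x, X x -> enorm x <= Rad) ->
  a (~` X) = 0%E -> b (~` X) = 0%E ->
  (SUOT sigma C1 phi1 phi2 a b <= USOT sigma C1 phi1 phi2 a b)%E.
Proof.
move=> [sT sS _] mC1 C10 H1 H2 _ _ _ _.
apply: le_ereal_inf_tmp => _ [p1 [p2 ->]].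
have SOT0 : (0 <= SOT sigma C1 p1 p2)%E.
  apply: integral_ge0 => theta _; apply: le_ereal_inf_tmp => _ [pi [_ _ ->]].
  exact: integral_ge0.
have D1 := divergence_gtNy p1 a H1; have D2 := divergence_gtNy p2 b H2.
rewrite -addeA; set c := (divergence _ _ _ + divergence _ _ _)%E.
have cNy : (-oo < c)%E by rewrite /c ltNye adde_eq_ninfty negb_or -!ltNye D1.
(* An infinite [c] makes the right-hand side infinite, since the transport term is nonnegative. *)
have [cfin|] := boolP (c \is a fin_num); last first.
  rewrite fin_numElt cNy /= -leNgt leye_eq => /eqP ->.
  by rewrite addey ?leey// gt_eqF// (lt_le_trans _ SOT0).
pose m1 theta := finite_pushforward p1 (measurable_proj theta).
pose m2 theta := finite_pushforward p2 (measurable_proj theta).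
have sfin : (sigma setT < +oo)%E by rewrite sT ltry.
have m1T theta : m1 theta setT = (fine (p1 setT))%:E.
  by rewrite fineK// fin_num_measure.
have [F1 [F2 [N [mF1 mF2 mN N0 FP]]]] := OT_sandwich sfin mC1 C10
  (measurable_proj_law p1) (measurable_proj_law p2) m1T.
have mS := @measurable_sphere R d.
(* The measurable majorant [F2] replaces the transport cost, so that its integral can be separated
   from that of the constant, whose sign is arbitrary. *)
have UF theta : (UOT C1 phi1 phi2 (pushforward a (Defs.proj theta)) (pushforward b (Defs.proj theta))
    <= F2 theta + (fine c)%:E)%E.
  apply: (@le_trans _ _ (OT C1 (m1 theta) (m2 theta) + (fine c)%:E)%E); last first.
    by apply: leeD => //; have [] := FP theta.
  apply: UOT_le; rewrite fineK//; apply: leeD; apply: divergence_pushforward_le => //;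
    exact: measurable_proj.
apply: le_trans; first by apply: le_integral_pointwise => theta _; exact: UF.
rewrite integral_ge0D_integrable//; last 3 first.
- exact: measurable_funTS.
- move=> theta _; have [F10 F1F FF2 _] := FP theta.
  exact: le_trans F10 (le_trans F1F FF2).
- apply/integrableP; split; first exact: measurable_cst.
  by rewrite integral_cst// [X in (_ * X)%E]sS mule1 ltry.
rewrite integral_cst// [X in (_ + _ * X)%E]sS mule1 fineK//; apply: leeD => //.
(* Back from the majorant: [F2] equals [F1] off the null set [N], and [F1] lies below the transport
   cost. *)
rewrite (_ : integral _ _ _ = \int[sigma]_(theta in @Defs.sphere R d) F1 theta)%E; last first.
  apply: ge0_ae_eq_integral => //.
  - exact: measurable_funTS.
  - exact: measurable_funTS.
  - move=> theta _; have [F10 F1F FF2 _] := FP theta.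
    exact: le_trans F10 (le_trans F1F FF2).
  - by move=> theta _; have [] := FP theta.
  - exists N; split => // theta /= h; apply: contrapT => nN; apply: h => _.
    by have [_ _ _ ->] := FP theta.
by apply: le_integral_pointwise => theta _; have [] := FP theta.
Qed.
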